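(* Let $n\geq 2$, let $\lambda$ be an arc in $\mathbb{R}^n$, and let $\Omega\subset\mathbb{R}^n$ be an open set containing $\lambda$. Then there is a simple closed curve $\gamma\subset\Omega$ with $\lambda\subset\gamma$ such that the open arc $\gamma\setminus\lambda$ is $\mathcal{C}^\infty$-smooth.
   Context: An arc is a space homeomorphic to $[0,1]$; a simple closed curve is a space homeomorphic to the unit circle. *)

(* Defs.v *)
From HB Require Import structures.
From mathcomp Require Import all_boot all_order all_algebra.
From mathcomp Require Import all_classical all_reals all_analysis.
Set Implicit Arguments. Unset Strict Implicit. Unset Printing Implicit Defensive.
Import Order.TTheory GRing.Theory Num.Theory.
Import numFieldNormedType.Exports.
Local Open Scope classical_set_scope.
Local Open Scope ring_scope.

(* R^n is modelled as row vectors 'rV[R]_n over a realType R, with the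
   product (max-norm) topology, which is the Euclidean topology. *)

Definition homeomorphic (S T : topologicalType) (A : set S) (B : set T) : Prop :=
  exists (f : S -> T) (g : T -> S),
    [/\ {within A, continuous f}, {within B, continuous g},
        f @` A `<=` B /\ g @` B `<=` A &
        (forall x, A x -> g (f x) = x) /\ (forall y, B y -> f (g y) = y)].

Definition unit_circle (R : realType) : set 'rV[R]_2 :=
  [set x | x ord0 ord0 ^+ 2 + x ord0 (@Ordinal 2 1 isT) ^+ 2 = 1].

Definition is_arc (R : realType) (n : nat) (A : set 'rV[R]_n) : Prop :=
  homeomorphic (`[0, 1] : set R) A.

Definition is_simple_closed_curve (R : realType) (n : nat) (C : set 'rV[R]_n) : Prop :=
  homeomorphic (@unit_circle R) C.

Definition smooth_open_arc (R : realType) (n : nat) (A : set 'rV[R]_n) : Prop :=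
  exists (h : R -> 'rV[R]_n) (g : 'rV[R]_n -> R),
    [/\ {within `]0, 1[, continuous h} /\ {within A, continuous g},
        h @` `]0, 1[ = A /\ g @` A `<=` `]0, 1[,
        (forall t : R, 0 < t < 1 -> g (h t) = t) /\ (forall y, A y -> h (g y) = y),
        (forall (k : nat) (t : R), 0 < t < 1 -> derivable (derive1n k h) t 1) &
        (forall t : R, 0 < t < 1 -> derive1 h t != 0)].

(* Main.v *)
Require Import Defs.
From HB Require Import structures.
From mathcomp Require Import all_boot all_order all_algebra.
From mathcomp Require Import all_classical all_reals all_analysis.
From mathcomp Require Import ring lra zify.
Import Order.TTheory GRing.Theory Num.Theory.
Import numFieldNormedType.Exports.
Local Open Scope classical_set_scope.
Local Open Scope ring_scope.

(** The key point is that an arc does not separate R^n, n >= 2, even locally at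
    its endpoints.

    This rests on Janiszewski's lemma: if A, B are closed, A /\ B is empty or one point, A and
    B are bounded in the latter case, and x, y can be joined off A and off B,
    then they can be joined off A \/ B. A loop that goes from x to y off A and
    returns off B is homotopic, off A /\ B, to a loop off A \/ B, whereas a
    separation of x from y would give it winding number 1 with respect to the
    obvious two-set cocycle. Adding small subarcs one at a time, each contained
    in a cube that misses x and y, shows that an arc does not separate; adding a
    small sphere to the far part of the arc gives the local version.

    Hence there are paths off the arc, inside Omega, that join a sequence of
    points tending to one endpoint to a sequence tending to the other. Covering
    them by balls and jumping each time to the last ball that meets the current
    one yields a two-sided simple chain of convex open sets: consecutive ones
    meet, the others are disjoint. A polygon with one vertex in each consecutive
    intersection, with its corners rounded inside these intersections, is
    automatically simple, smooth and regular. *)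

Set Implicit Arguments.
Unset Strict Implicit.
Unset Printing Implicit Defensive.

(** * Janiszewski's lemma *)

(** No homotopy theory or degree is used: the winding number is a sum of integer jumps along the
    edges of a fine grid, and its invariance is a cancellation over small squares. Janiszewski's
    lemma also keeps the paths inside Omega: it is applied to the arc and the complement of Omega,
    which are disjoint, and the arc itself serves as the path that avoids the complement. Smoothness
    is asked only off the arc, so infinitely many pieces may accumulate at its endpoints, where
    continuity alone has to be secured. Hence the need for local non-separation: successive approach
    points must be linked inside balls that shrink to the endpoint. Each ball of the chain stays at
    positive distance from both endpoints, so it meets only finitely many of the others, and a last
    one exists. *)

Lemma lebesgue_number (R : realType) (X : pseudoMetricType R) (K : set X)
    (U : set (set X)) : compact K ->
  (forall x, K x -> exists2 E, U E & nbhs x E) ->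
  exists2 e : R, 0 < e & forall x, K x -> exists2 E, U E & ball x e `<=` E.
Proof.
move=> /compact_near_coveringP cK cov.
have := cK R 0^'+ (fun e x => exists2 E, U E & ball x e `<=` E) _ _.
case.
- move=> x Kx; have [E UE /nbhs_ballP[r /= r0 rE]] := cov x Kx.
  exists (ball x (r / 2), [set e | 0 < e < r / 2]) => /=.
    split; first exact: nbhsx_ballx (divr_gt0 r0 _).
    near=> e; apply/andP; split => //=.
    by near: e; apply: nbhs_right_lt; rewrite divr_gt0.
  move=> [x' e] /= [xx' /andP[e0 er]]; exists E => // y x'y.
  apply: rE; rewrite [r]splitr; apply: ball_triangle xx' _.
  exact: le_ball (ltW er) _ x'y.
- move=> e e0 /= H; exists (e / 2); first exact: divr_gt0.
  move=> x Kx; apply: (H (e / 2)) => //=; last by rewrite divr_gt0.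
  rewrite /ball_ /= sub0r normrN gtr0_norm ?divr_gt0//.
  by rewrite ltr_pdivrMr// mulr_natr mulr2n ltrDl.
Unshelve. all: by end_near. Qed.

Definition conn (R : realType) (V : normedModType R) (O : set V) (x y : V) :=
  exists2 l : R -> V, continuous l &
    [/\ l 0 = x, l 1 = y & forall t, 0 <= t <= 1 -> O (l t)].

Lemma conn_sub (R : realType) (V : normedModType R) (O O' : set V) (x y : V) :
  O `<=` O' -> conn O x y -> conn O' x y.
Proof.
move=> OO' [l cl [l0 l1 lO]]; exists l => //; split => // t t01.
exact/OO'/lO.
Qed.

Lemma line_continuous (R : realType) (V : normedModType R) (x v : V) :
  continuous (fun t : R => x + t *: v).
Proof.
move=> t; apply: cvgD; first exact: cvg_cst.
by apply: cvgZr_tmp; exact: cvg_id.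
Qed.

Lemma conn_segment (R : realType) (V : normedModType R) (O : set V) (x y : V) :
  (forall t : R, 0 <= t <= 1 -> O (x + t *: (y - x))) -> conn O x y.
Proof.
move=> xyO; exists (fun t => x + t *: (y - x)); first exact: line_continuous.
by split => //; rewrite ?scale0r ?addr0// scale1r addrC subrK.
Qed.

Lemma conn_refl (R : realType) (V : normedModType R) (O : set V) (x : V) :
  O x -> conn O x x.
Proof. by move=> Ox; apply: conn_segment => t _; rewrite subrr scaler0 addr0. Qed.

Lemma conn_sym (R : realType) (V : normedModType R) (O : set V) (x y : V) :
  conn O x y -> conn O y x.
Proof.
move=> [l cl [l0 l1 lO]]; exists (fun t => l (1 - t)).
  move=> t; apply: continuous_comp; last exact: cl.
  by apply: cvgB; [exact: cvg_cst|exact: cvg_id].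
by split; rewrite ?subr0 ?subrr// => t t01; apply: lO; lra.
Qed.

Lemma conn_trans (R : realType) (V : normedModType R) (O : set V) (x y z : V) :
  conn O x y -> conn O y z -> conn O x z.
Proof.
move=> [k ck [k0 k1 kO]] [l cl [l0 l1 lO]].
(* At every time of the unit interval one of the two paths rests at [y], which the last term
   removes; continuity then needs no case split. *)
exists (fun t => k (Num.min (2 * t) 1) + l (Num.max (2 * t - 1) 0) - y).
  have c2 (t : R) : {for t, continuous (fun t : R => 2 * t)}.
    by apply: cvgM; [exact: cvg_cst|exact: cvg_id].
  move=> t; apply: cvgB; last exact: cvg_cst.
  apply: cvgD.
    apply: continuous_cvg; first exact: ck.
    by apply: (@continuous_min _ _ (fun t : R => 2 * t) (fun=> 1));
      [exact: c2|exact: cvg_cst].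
  apply: continuous_cvg; first exact: cl.
  apply: (@continuous_max _ _ (fun t : R => 2 * t - 1) (fun=> 0)); last exact: cvg_cst.
  by apply: cvgB; [exact: c2|exact: cvg_cst].
split.
- rewrite mulr0 sub0r minEle maxEle ler01 lerN10 k0 l0.
  by rewrite addrK.
- rewrite mulr1 minEle maxEle (_ : (2 <= 1 :> R) = false); last by apply/negP; lra.
  rewrite (_ : 2 - 1 = 1 :> R); last by lra.
  by rewrite (lt_geF ltr01) k1 l1 addrC addKr.
- move=> t t01; have [t2|t2] := leP (2 * t) 1.
    rewrite max_r; last lra.
    by rewrite l0 addrK; apply: kO; lra.
  rewrite max_l; last lra.
  by rewrite k1 [y + _]addrC addrK; apply: lO; lra.
Qed.

Definition seg_in (R : realType) (V : normedModType R) (O : set V) (x y : V) :=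
  forall t : R, 0 <= t <= 1 -> O (x + t *: (y - x)).

Lemma ball_segment (R : realType) (V : normedModType R) (c x y : V) (e : R) :
  ball c e x -> ball c e y -> seg_in (ball c e) x y.
Proof.
rewrite -ball_normE => cx cy t /andP[t0 t1]; rewrite /ball_/= in cx cy *.
have -> : c - (x + t *: (y - x)) = (1 - t) *: (c - x) + t *: (c - y).
  rewrite scalerBl scale1r opprD addrA -[RHS]addrA; congr (_ + _).
  by rewrite -!scalerN -scalerDr !opprB addrA subrK.
apply: le_lt_trans (ler_normD _ _) _.
rewrite !normrZ (ger0_norm t0) ger0_norm ?subr_ge0//.
have [->|tn0] := eqVneq t 0; first by rewrite subr0 mul1r mul0r addr0.
have tp : 0 < t by rewrite lt_neqAle eq_sym tn0.
rewrite [ltRHS](_ : _ = (1 - t) * e + t * e); last by ring.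
by rewrite ler_ltD ?ltr_pM2l// ler_wpM2l ?subr_ge0// ltW.
Qed.

(** Balls inside members of the cover are convex, so a Lebesgue number for their preimages controls
    whole chords. The discrete sums below see only chords. *)
Lemma uniform_seg_in (R : realType) (V : normedModType R)
    (X : pseudoMetricType R) (K : set X) (F : X -> V) (U : set (set V)) :
  compact K -> (forall x, K x -> {for x, continuous F}) ->
  (forall x, K x -> exists O, [/\ U O, open O & O (F x)]) ->
  exists2 e : R, 0 < e & forall x, K x -> exists2 O, U O &
    forall x1 x2, ball x e x1 -> ball x e x2 -> seg_in O (F x1) (F x2).
Proof.
move=> cK cF cov.
have [x Kx|e e0 H] := @lebesgue_number R X K
  [set E | exists2 O, U O & forall x1 x2, E x1 -> E x2 -> seg_in O (F x1) (F x2)] cK.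
  have [G [UO oO OF]] := cov x Kx.
  have /nbhs_ballP[r /= r0 rO] := open_nbhs_nbhs (conj oO OF).
  exists (F @^-1` ball (F x) r); last by apply: cF => //; exact: nbhsx_ballx.
  by exists G => // x1 x2 x1E x2E t t01; apply/rO/ball_segment.
exists e => // x Kx; have [E [G UO EO] xE] := H x Kx.
by exists G => // x1 x2 /xE E1 /xE E2; exact: EO.
Qed.

(** * Jumps along edges and their sums over a grid *)

Section Grid.
Context {R : realType} {V : normedModType R}.

Definition unit_square : set (R * R) :=
  [set p | (0 <= p.1 <= 1) /\ (0 <= p.2 <= 1)].

Lemma unit_square_compact : compact unit_square.
Proof.
rewrite (_ : unit_square = (`[0, 1] : set R) `*` (`[0, 1] : set R)).
  by apply: compact_setX; exact: segment_compact.
by apply/seteqP; split => -[s t] /=; rewrite /unit_square /= !in_itv.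
Qed.

Definition node (N i : nat) : R := i%:R / N.+1%:R.

Lemma node0 N : node N 0 = 0. Proof. by rewrite /node mul0r. Qed.

Lemma nodeN N : node N N.+1 = 1. Proof. by rewrite /node divff. Qed.

Lemma node01 N i : (i <= N.+1)%N -> 0 <= node N i <= 1.
Proof.
by move=> iN; rewrite divr_ge0//= ler_pdivrMr// mul1r ler_nat.
Qed.

Lemma node_ball N i (e : R) : N.+1%:R^-1 < e -> ball (node N i) e (node N i.+1).
Proof.
move=> Ne; rewrite -ball_normE /= distrC /node -mulrBl -[i.+1]addn1 natrD.
by rewrite addrAC subrr add0r mul1r ger0_norm.
Qed.

(** A 1-cochain on straight edges: zero off [A], and otherwise the coboundary of the indicator of
    the component of [x]. It is meant for edges that miss [A] or [B]. *)
Definition edge_jump (A B : set V) (x : V) (a b : V) : int :=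
  if `[< seg_in (~` A) a b >] then 0
  else (`[< conn (~` (A `|` B)) x b >] : nat)%:Z - (`[< conn (~` (A `|` B)) x a >] : nat)%:Z.

Lemma edge_jumpA (A B : set V) (x a b : V) :
  seg_in (~` A) a b -> edge_jump A B x a b = 0.
Proof. by move=> ab; rewrite /edge_jump; case: asboolP. Qed.

(** An edge that misses [A] as well joins its ends off the union, so the indicator does not change
    along it and the two rules agree. *)
Lemma edge_jumpB (A B : set V) (x a b : V) : seg_in (~` B) a b ->
  edge_jump A B x a b = (`[< conn (~` (A `|` B)) x b >] : nat)%:Z
     - (`[< conn (~` (A `|` B)) x a >] : nat)%:Z.
Proof.
move=> abB; rewrite /edge_jump; case: asboolP => // abA.
have ab : conn (~` (A `|` B)) a b.
  by apply: conn_segment => t t01 [/(abA t t01)|/(abB t t01)].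
suff -> : `[< conn (~` (A `|` B)) x b >] = `[< conn (~` (A `|` B)) x a >].
  by rewrite subrr.
by apply/asboolP/asboolP => h; apply: conn_trans h _ => //; exact: conn_sym.
Qed.

(** A discrete Stokes formula. Since [F] avoids the intersection, the chords of each cell of a fine
    grid all miss [A] or all miss [B]; the jump is then zero or the difference of one function, so
    it is closed on the cell, and inner edges cancel. *)
Lemma grid_sum (A B : set V) (x : V) (F : R * R -> V) :
  closed A -> closed B ->
  (forall p, unit_square p -> {for p, continuous F}) ->
  (forall p, unit_square p -> ~ (A `&` B) (F p)) ->
  \forall N \near \oo,
  let d := edge_jump A B x in
  \sum_(i < N.+1) d (F (node N i, 0)) (F (node N i.+1, 0))
  - \sum_(i < N.+1) d (F (node N i, 1)) (F (node N i.+1, 1))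
  = \sum_(j < N.+1) d (F (0, node N j)) (F (0, node N j.+1))
  - \sum_(j < N.+1) d (F (1, node N j)) (F (1, node N j.+1)).
Proof.
move=> cA cB cF FAB.
have [p Kp|e e0 H] := @uniform_seg_in R V _ unit_square F
    [set O | O = ~` A \/ O = ~` B] unit_square_compact cF.
   have /not_andP[h|h] := FAB p Kp.
    by exists (~` A); split => //; [left|rewrite openC].
  by exists (~` B); split => //; [right|rewrite openC].
near=> N => /=.
have Ne : N.+1%:R^-1 < e by near: N; exact: near_infty_natSinv_lt (PosNum e0).
set d := edge_jump A B x.
have sq i j : (i < N.+1)%N -> (j < N.+1)%N ->
    d (F (node N i, node N j)) (F (node N i.+1, node N j))
  - d (F (node N i, node N j.+1)) (F (node N i.+1, node N j.+1))
  = d (F (node N i, node N j)) (F (node N i, node N j.+1))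
  - d (F (node N i.+1, node N j)) (F (node N i.+1, node N j.+1)).
  move=> iN jN; have [|O OAB sO] := H (node N i, node N j).
    by split; rewrite /= node01 // ltnW.
  have b00 : ball (node N i, node N j) e (node N i, node N j) by exact: ballxx.
  have b10 : ball (node N i, node N j) e (node N i.+1, node N j).
    by split => /=; [exact: node_ball|exact: ballxx].
  have b01 : ball (node N i, node N j) e (node N i, node N j.+1).
    by split => /=; [exact: ballxx|exact: node_ball].
  have b11 : ball (node N i, node N j) e (node N i.+1, node N j.+1).
    by split => /=; exact: node_ball.
  case: OAB => OE; rewrite OE in sO.
    by rewrite /d !edge_jumpA//; exact: sO.
  by rewrite /d !edge_jumpB//; [ring|exact: sO..].
have : \sum_(j < N.+1) \sum_(i < N.+1)
      (d (F (node N i, node N j)) (F (node N i.+1, node N j))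
      - d (F (node N i, node N j.+1)) (F (node N i.+1, node N j.+1)))
    = \sum_(j < N.+1) \sum_(i < N.+1)
      (d (F (node N i, node N j)) (F (node N i, node N j.+1))
      - d (F (node N i.+1, node N j)) (F (node N i.+1, node N j.+1))).
  by apply: eq_bigr => j _; apply: eq_bigr => i _; exact: sq.
rewrite [in RHS]exchange_big /=.
pose a j := \sum_(i < N.+1) d (F (node N i, node N j)) (F (node N i.+1, node N j)).
pose b i := \sum_(j < N.+1) d (F (node N i, node N j)) (F (node N i, node N j.+1)).
rewrite (eq_bigr (fun j : 'I_N.+1 => a j - a j.+1)); last by move=> j _; rewrite sumrB.
rewrite [RHS](eq_bigr (fun i : 'I_N.+1 => b i - b i.+1)); last by move=> i _; rewrite sumrB.
have tel (f : nat -> int) : \sum_(i < N.+1) (f i - f i.+1) = f 0%N - f N.+1.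
  rewrite -(big_mkord xpredT (fun i => f i - f i.+1)).
  under eq_bigr do rewrite -opprB.
  by rewrite sumrN telescope_sumr// opprB.
by rewrite !tel /a /b !node0 !nodeN.
Unshelve. all: by end_near. Qed.

End Grid.

Lemma pairl_continuous (R : realType) (t : R) : continuous (fun s : R => (s, t)).
Proof.
move=> s; have h : (s', t) @[s' --> s] --> filter_prod (nbhs s) (nbhs t).
  apply: (@cvg_pair R R R (nbhs s) (nbhs s) (nbhs t) _ _ _ id (fun=> t)).
    exact: cvg_id.
  exact: cvg_cst.
exact: h.
Qed.

Lemma path_seg_in (R : realType) (V : normedModType R) (l : R -> V) (O : set V) :
  open O -> (forall t, 0 <= t <= 1 -> {for t, continuous l}) ->
  (forall t, 0 <= t <= 1 -> O (l t)) ->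
  \forall N \near \oo, forall i, (i < N.+1)%N ->
    seg_in O (l (node N i)) (l (node N i.+1)).
Proof.
move=> oO cl lO.
have [t /= t01|e e0 H] := @uniform_seg_in R V R `[0, 1] l [set O]
    (@segment_compact _ _ _) cl; first by exists O; split => //; exact: lO.
near=> N => i iN.
have Ne : N.+1%:R^-1 < e by near: N; exact: near_infty_natSinv_lt (PosNum e0).
have [|_ -> sO] := H (node N i); first by rewrite /= in_itv /= node01// ltnW.
by apply: sO; [exact: ballxx|exact: node_ball].
Unshelve. all: by end_near. Qed.

(* If [x] and [y] were not connected off [A `|` B], the indicator of the
   component of [x] would be a locally constant primitive of the edge jumps
   off [B], while the jumps vanish off [A]. So the loop that goes from [x] to
   [y] off [A] and back off [B] would have total jump -1, and a homotopy
   avoiding [A `&` B] to a loop off [A `|` B] does not change the total. *)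
Lemma homotopy_conn (R : realType) (V : normedModType R) (A B : set V) (x y : V)
    (Fa Fb : R * R -> V) : closed A -> closed B ->
  (forall p, unit_square p -> {for p, continuous Fa}) ->
  (forall p, unit_square p -> {for p, continuous Fb}) ->
  (forall p, unit_square p -> ~ (A `&` B) (Fa p)) ->
  (forall p, unit_square p -> ~ (A `&` B) (Fb p)) ->
  (forall s, 0 <= s <= 1 -> ~ A (Fa (s, 0))) ->
  (forall s, 0 <= s <= 1 -> ~ B (Fb (s, 0))) ->
  (forall s, 0 <= s <= 1 -> ~ (A `|` B) (Fa (s, 1))) ->
  (forall s, 0 <= s <= 1 -> ~ (A `|` B) (Fb (s, 1))) ->
  (forall t, Fa (0, t) = Fb (0, t)) -> (forall t, Fa (1, t) = Fb (1, t)) ->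
  Fa (0, 0) = x -> Fa (1, 0) = y -> conn (~` (A `|` B)) x y.
Proof.
move=> cA cB cFa cFb aAB bAB a0 b0 a1 b1 ab0 ab1 Fx Fy.
have i0 : 0 <= (0 : R) <= 1 by rewrite lexx ler01.
have i1 : 0 <= (1 : R) <= 1 by rewrite lexx ler01.
have Wx : (~` (A `|` B)) x.
  by case => [|]; rewrite -Fx; [exact: a0|rewrite ab0; exact: b0].
apply: contrapT => Nxy.
have cs (F : R * R -> V) t : 0 <= t <= 1 ->
    (forall p, unit_square p -> {for p, continuous F}) ->
    forall s, 0 <= s <= 1 -> {for s, continuous (fun s => F (s, t))}.
  move=> t01 cF s s01; apply: (@continuous_comp _ _ _ (fun s => (s, t)) F).
    exact: pairl_continuous.
  exact: cF.
have oA : open (~` A) by rewrite openC.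
have oB : open (~` B) by rewrite openC.
have : \forall N \near \oo, False; last first.
  by case=> N _ /(_ N (leqnn _)).
near=> N.
have ea : forall i, (i < N.+1)%N ->
    seg_in (~` A) (Fa (node N i, 0)) (Fa (node N i.+1, 0)).
  by near: N; apply: (path_seg_in (l := fun s => Fa (s, 0))) => //; exact: cs.
have eb : forall i, (i < N.+1)%N ->
    seg_in (~` B) (Fb (node N i, 0)) (Fb (node N i.+1, 0)).
  by near: N; apply: (path_seg_in (l := fun s => Fb (s, 0))) => //; exact: cs.
have ea1 : forall i, (i < N.+1)%N ->
    seg_in (~` A) (Fa (node N i, 1)) (Fa (node N i.+1, 1)).
  near: N; apply: (path_seg_in (l := fun s => Fa (s, 1))) => //; first exact: cs.
  by move=> s /a1 h ?; apply: h; left.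
have eb1 : forall i, (i < N.+1)%N ->
    seg_in (~` A) (Fb (node N i, 1)) (Fb (node N i.+1, 1)).
  near: N; apply: (path_seg_in (l := fun s => Fb (s, 1))) => //; first exact: cs.
  by move=> s /b1 h ?; apply: h; left.
have := near (grid_sum x cA cB cFa aAB) N.
have := near (grid_sum x cA cB cFb bAB) N.
move=> /(_ _)/wrap[//|] /= gb /(_ _)/wrap[//|] /=.
set d := edge_jump A B x in gb *.
(* The homotopies share their lateral sides, so the two grid identities have equal right members.
   Three of the four horizontal sums vanish because their edges miss [A]; the one at the bottom of
   [Fb] telescopes to -1. *)
under [X in _ - _ = X - _]eq_bigr do rewrite !ab0.
under [X in _ - _ = _ - X]eq_bigr do rewrite !ab1.
rewrite -gb [X in X - _]big1; last by move=> i _; exact/edge_jumpA/ea.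
rewrite [X in _ - X]big1; last by move=> i _; exact/edge_jumpA/ea1.
rewrite [X in _ = _ - X]big1; last by move=> i _; exact/edge_jumpA/eb1.
rewrite /d (eq_bigr (fun i : 'I_N.+1 =>
    (`[< conn (~` (A `|` B)) x (Fb (node N i.+1, 0)) >] : nat)%:Z
     - (`[< conn (~` (A `|` B)) x (Fb (node N i, 0)) >] : nat)%:Z)); last first.
  by move=> i _; exact/edge_jumpB/eb.
rewrite -(big_mkord xpredT (fun i =>
    (`[< conn (~` (A `|` B)) x (Fb (node N i.+1, 0)) >] : nat)%:Z
     - (`[< conn (~` (A `|` B)) x (Fb (node N i, 0)) >] : nat)%:Z)).
rewrite telescope_sumr// node0 nodeN -ab0 -ab1 Fx Fy.
rewrite (asboolF Nxy) (asboolT (conn_refl Wx)).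
by [].
Unshelve. all: by end_near. Qed.

(** With no common point to avoid, both paths contract straight to [x]: their start stays fixed and
    their ends move along the same segment. *)
Lemma conn_setU_disjoint (R : realType) (V : normedModType R) (A B : set V)
    (x y : V) : closed A -> closed B -> A `&` B `<=` set0 ->
  conn (~` A) x y -> conn (~` B) x y -> conn (~` (A `|` B)) x y.
Proof.
move=> cA cB AB [a ca [ax ay aA]] [b cb [bx b_y bB]].
have i0 : 0 <= (0 : R) <= 1 by rewrite lexx ler01.
pose F (l : R -> V) (p : R * R) := l p.1 + p.2 *: (x - l p.1).
have cF (l : R -> V) : continuous l -> continuous (F l).
  move=> cl p; have c1 : l p'.1 @[p' --> p] --> l p.1.
    by apply: continuous_cvg; [exact: cl|exact: cvg_fst].
  apply: cvgD => //; apply: cvgZ; first exact: cvg_snd.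
  by apply: cvgB; [exact: cvg_cst|exact: c1].
have F1 l s : F l (s, 1) = x by rewrite /F /= scale1r addrC subrK.
have F0 l s : F l (s, 0) = l s by rewrite /F /= scale0r addr0.
have Wx : ~ (A `|` B) x.
  by case=> [|]; [rewrite -ax|rewrite -bx]; [exact: aA|exact: bB].
apply: (@homotopy_conn _ _ A B x y (F a) (F b)) => //.
- by move=> p _; exact: cF.
- by move=> p _; exact: cF.
- by move=> p _ /AB.
- by move=> p _ /AB.
- by move=> s s01; rewrite F0; exact: aA.
- by move=> s s01; rewrite F0; exact: bB.
- by move=> s _; rewrite F1.
- by move=> s _; rewrite F1.
- by move=> t; rewrite /F /= ax bx.
- by move=> t; rewrite /F /= ay b_y.
- by rewrite F0.
- by rewrite F0.
Qed.

(* The homotopy expands the two paths radially from [c], the only point that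
   they have to avoid. *)
Lemma conn_setU_point (R : realType) (V : normedModType R) (A B : set V)
    (c x y : V) (r : R) : closed A -> closed B -> A c -> B c ->
  A `&` B `<=` [set c] -> A `|` B `<=` ball c r ->
  conn (~` A) x y -> conn (~` B) x y -> conn (~` (A `|` B)) x y.
Proof.
move=> cA cB Ac Bc AB ABr [a ca [ax ay aA]] [b cb [bx b_y bB]].
have i0 : 0 <= (0 : R) <= 1 by rewrite lexx ler01.
have r0 : 0 < r.
  by have := ABr _ (or_introl Ac); rewrite -ball_normE /= subrr normr0.
(* The factor lengthens [l p.1 - c] by exactly [p.2 * r], so at [p.2 = 1] the point has left the
   ball that contains [A] and [B]. *)
pose F (l : R -> V) (p : R * R) :=
  c + (1 + p.2 * (r / `|l p.1 - c|)) *: (l p.1 - c).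
have cF (l : R -> V) : continuous l -> (forall t, 0 <= t <= 1 -> l t != c) ->
    forall p, unit_square p -> {for p, continuous (F l)}.
  move=> cl lc p [p1 p2]; have c1 : l p'.1 - c @[p' --> p] --> l p.1 - c.
    apply: cvgB; last exact: cvg_cst.
    by apply: continuous_cvg; [exact: cl|exact: cvg_fst].
  apply: cvgD; first exact: cvg_cst.
  apply: cvgZ => //; apply: cvgD; first exact: cvg_cst.
  apply: cvgM; first exact: cvg_snd.
  apply: cvgM; first exact: cvg_cst.
  apply: cvgV; first by rewrite normr_eq0 subr_eq0 lc.
  exact: cvg_norm c1.
have F0 l s : F l (s, 0) = l s.
  by rewrite /F /= mul0r addr0 scale1r addrC subrK.
have nF (l : R -> V) p : 0 <= p.2 -> l p.1 != c ->
    `|c - F l p| = `|l p.1 - c| + p.2 * r.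
  move=> p2 lc; rewrite /F opprD addrA subrr add0r normrN normrZ.
  have lc0 : 0 < `|l p.1 - c| by rewrite normr_gt0 subr_eq0.
  rewrite ger0_norm; last by rewrite addr_ge0// mulr_ge0// divr_ge0// ltW.
  by rewrite mulrDl mul1r -mulrA divfK// gt_eqF.
have FAB (l : R -> V) : (forall t, 0 <= t <= 1 -> l t != c) ->
    forall p, unit_square p -> ~ (A `&` B) (F l p).
  move=> lc p [p1 /andP[p2 _]] /AB Fc; have := nF l p p2 (lc _ p1).
  rewrite Fc subrr normr0 => /esym/eqP; rewrite paddr_eq0 ?mulr_ge0// ?ltW//.
  by rewrite normr_eq0 subr_eq0 (negPf (lc _ p1)).
have F1 (l : R -> V) : (forall t, 0 <= t <= 1 -> l t != c) ->
    forall s, 0 <= s <= 1 -> ~ (A `|` B) (F l (s, 1)).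
  move=> lc s s01 /ABr; rewrite -ball_normE /= nF//= ?lc// mul1r.
  by rewrite ltNge lerDr normr_ge0.
have ac t : 0 <= t <= 1 -> a t != c.
  by move=> t01; apply/eqP => tc; apply: (aA t t01); rewrite tc.
have bc t : 0 <= t <= 1 -> b t != c.
  by move=> t01; apply/eqP => tc; apply: (bB t t01); rewrite tc.
apply: (@homotopy_conn _ _ A B x y (F a) (F b)) => //.
- exact: cF.
- exact: cF.
- exact: FAB.
- exact: FAB.
- by move=> s s01; rewrite F0; exact: aA.
- by move=> s s01; rewrite F0; exact: bB.
- exact: F1.
- exact: F1.
- by move=> t; rewrite /F /= ax bx.
- by move=> t; rewrite /F /= ay b_y.
- by rewrite F0.
- by rewrite F0.
Qed.

(** * Arcs do not separate *)

Lemma dist_continuous (R : realType) (V : normedModType R) (c : V) :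
  continuous (fun z => `|c - z|).
Proof.
by move=> z; apply: cvg_norm; apply: cvgB; [exact: cvg_cst|exact: cvg_id].
Qed.

(** A point is outside a max-norm ball as soon as one coordinate is, and stays outside while that
    coordinate is kept. If the two points are outside through different coordinates, an intermediate
    point takes one of them from each; otherwise another coordinate is pushed out first, and this is
    where [2 <= n] enters. *)
Lemma conn_outside_cube (R : realType) (n : nat) (hn : (2 <= n)%N)
    (c x y : 'rV[R]_n) (r : R) :
  0 < r -> ~ ball c r x -> ~ ball c r y -> conn (~` ball c r) x y.
Proof.
move=> r0; pose out (i : 'I_n) (z : 'rV[R]_n) := ~ ball (c 0 i) r (z 0 i).
have outP z : ~ ball c r z -> exists i, out i z.
  move=> Nz; apply: contrapT => /forallNP h; apply: Nz; split => // i j.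
  by rewrite ord1; apply: contrapT; exact: h.
have step i (z w : 'rV[R]_n) : out i z -> z 0 i = w 0 i -> conn (~` ball c r) z w.
  move=> oz zw; apply: conn_segment => t _ [_ /(_ 0 i)].
  by rewrite !mxE -zw subrr mulr0 addr0.
have two i j (z w : 'rV[R]_n) : i != j -> out i z -> out j w ->
    conn (~` ball c r) z w.
  move=> ij oz ow; pose u : 'rV[R]_n := \row_k (if k == j then w 0 j else z 0 k).
  apply: (@conn_trans _ _ _ _ u).
    by apply: (step i) => //; rewrite mxE (negPf ij).
  by apply: (step j); rewrite /out mxE eqxx.
move=> /outP[i ox] /outP[j oy]; have [ij|/two] := eqVneq i j; last exact.
subst j; have [k ki] : exists k : 'I_n, k != i.
  apply: contrapT => /forallNP h; move: hn; rewrite -[n]card_ord => /card_gt1P[a [b [_ _ /negP ab]]]; apply: ab.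
  by move: (h a) (h b) => /negP/negPn/eqP -> /negP/negPn/eqP ->.
pose u : 'rV[R]_n := \row_l (if l == k then c 0 k + r else x 0 l).
apply: (@conn_trans _ _ _ _ u).
  by apply: (step i) => //; rewrite mxE eq_sym (negPf ki).
apply: (two k i) => //; rewrite /out mxE eqxx -ball_normE /=.
by rewrite opprD addrA subrr add0r normrN => /ltr_normlW; rewrite ltxx.
Qed.

Section Arc.
Context {R : realType} {n : nat}.
Variables (f : R -> 'rV[R]_n).
Hypotheses (hn : (2 <= n)%N) (cf : continuous f)
  (fI : forall s t, 0 <= s <= 1 -> 0 <= t <= 1 -> f s = f t -> s = t).

Let piece (a b : R) : set 'rV[R]_n := f @` `[a, b].

Let piece_compact a b : compact (piece a b).
Proof.
apply: continuous_compact; last exact: segment_compact.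
exact: continuous_subspaceT.
Qed.

Let piece_closed a b : closed (piece a b).
Proof. by apply: compact_closed; [exact: norm_hausdorff|exact: piece_compact]. Qed.

Let pieceU a b c : a <= b -> b <= c -> piece a c = piece a b `|` piece b c.
Proof.
move=> ab bc; rewrite -image_setU; congr (_ @` _); apply/seteqP.
split => t /=; rewrite !in_itv /=.
  by move=> /andP[ta tc]; have [tb|tb] := leP t b; [left|right]; rewrite ?ta ?tc ?tb ?ltW.
by case=> /andP[h1 h2]; rewrite ?h1 ?h2 ?andbT//=; [exact: le_trans bc|exact: le_trans h1].
Qed.

Let pieceI a b c : 0 <= a <= b -> b <= c <= 1 ->
  piece a b `&` piece b c `<=` [set f b].
Proof.
move=> /andP[a0 ab] /andP[bc c1] z [[s /= + <-] [t /= + /esym fst_]].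
rewrite !in_itv /= => /andP[sa sb] /andP[tb tc].
have st : s = t by apply: fI => //; lra.
by congr f; apply/eqP; rewrite eq_le sb st tb.
Qed.

Lemma compact_ball (A : set 'rV[R]_n) (c : 'rV[R]_n) :
  compact A -> exists r, A `<=` ball c r.
Proof.
move=> /compact_bounded[M [_ bM]]; exists (`|c| + (M + 1) + 1) => z Az.
rewrite -ball_normE /=; apply: le_lt_trans (ler_normB _ _) _.
rewrite -addrA ltrD2l; apply: (@le_lt_trans _ _ (M + 1)); last by rewrite ltrDl.
  by apply: bM => //; rewrite ltrDl.
Qed.

Lemma arc_conn (x y : 'rV[R]_n) : ~ (f @` `[0, 1]) x -> ~ (f @` `[0, 1]) y ->
  conn (~` (f @` `[0, 1])) x y.
Proof.
move=> Nx Ny.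
have [t|e e0 H] := @lebesgue_number R R `[0, 1] [set E | exists c r,
    [/\ 0 < r, E `<=` f @^-1` ball c r, ~ ball c r x & ~ ball c r y]]
    (@segment_compact _ _ _).
  rewrite /= => t01; pose r := Num.min `|f t - x| `|f t - y|.
  have r0 : 0 < r.
    rewrite /r lt_min !normr_gt0 !subr_eq0; apply/andP.
    by split; apply/eqP => ft; [apply: Nx|apply: Ny]; exists t.
  exists (f @^-1` ball (f t) r); last by apply: cf; exact: nbhsx_ballx.
  by exists (f t), r; split => //; rewrite -ball_normE /= lt_min ltxx ?andbF.
have [N Ne] : exists N, N.+1%:R^-1 < e.
  by have [N _ /(_ N (leqnn _))] := near_infty_natSinv_lt (PosNum e0); exists N.
have nodeS k : node N k <= node N k.+1 :> R.
  by rewrite /node ler_pM2r ?invr_gt0// ler_nat.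
have small k : (k < N.+1)%N -> exists c r,
    [/\ 0 < r, piece (node N k) (node N k.+1) `<=` ball c r, ~ ball c r x & ~ ball c r y].
  move=> kN; have [|E [c [r [r0 Ecr cx cy]]] kE] := H (node N k).
    by rewrite /= in_itv /= node01// ltnW.
  exists c, r; split => // _ [t /= + <-]; rewrite in_itv /= => /andP[t1 t2].
  suff tE : E t by exact: Ecr tE.
  apply: kE; rewrite -ball_normE /= distrC ger0_norm ?subr_ge0//.
  apply: le_lt_trans Ne; rewrite lerBlDl; apply: le_trans t2 _.
  by rewrite /node -[k.+1]addn1 natrD mulrDl mul1r.
suff : forall k, (k <= N.+1)%N -> conn (~` piece 0 (node N k)) x y.
  by move=> /(_ N.+1 (leqnn _)); rewrite nodeN.
elim=> [_|k IH kN].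
  (* The initial piece is the single point [f 0], which lies in the cube of the first subarc. *)
  have [c [r [r0 cr cx cy]]] := small 0%N isT.
  apply: conn_sub (conn_outside_cube hn r0 cx cy) => z Nz [t + tz].
  rewrite (node0 N) set_itvE /= => t0; apply/Nz/cr; exists t => //.
  rewrite /= t0 in_itv /= (node0 N) lexx /=.
  by rewrite -[leLHS](node0 N); exact: nodeS.
have /andP[k0 _] : 0 <= (node N k : R) <= 1 by rewrite node01// ltnW.
have /andP[_ k1] : 0 <= (node N k.+1 : R) <= 1 by rewrite node01.
rewrite (pieceU k0 (nodeS k)).
have [r Ar] := @compact_ball (piece 0 (node N k.+1)) (f (node N k)) (@piece_compact _ _).
apply: (@conn_setU_point _ _ _ _ (f (node N k)) _ _ r).
- exact: piece_closed.
- exact: piece_closed.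
- by exists (node N k) => //=; rewrite in_itv /= lexx k0.
- by exists (node N k) => //=; rewrite in_itv /= lexx nodeS.
- by apply: pieceI; rewrite ?lexx ?nodeS.
- by rewrite -pieceU.
- exact/IH/ltnW.
- have [c [s [r0 cs cx cy]]] := small k kN.
  by apply: conn_sub (conn_outside_cube hn r0 cx cy) => z Nz /cs.
Qed.

(** The near part [piece 0 a] stays strictly inside the sphere of radius [e / 2], so it meets the
    far part together with the sphere only at [f a]. The points are joined off the near part by
    [arc_conn], and off the other set by their segment. *)
Lemma arc_conn_ball (e : R) : 0 < e -> exists2 d : R, 0 < d &
  forall x y, ball (f 0) d x -> ball (f 0) d y ->
    ~ (f @` `[0, 1]) x -> ~ (f @` `[0, 1]) y ->
    conn (ball (f 0) e `\` f @` `[0, 1]) x y.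
Proof.
move=> e0; have e2 : 0 < e / 2 by rewrite divr_gt0.
have [a /andP[a0 a1] fa] : exists2 a : R, 0 < a <= 1 &
    forall t, 0 <= t <= a -> ball (f 0) (e / 2) (f t).
  have /nbhs_ballP[r /= r0 rf] := cf (nbhsx_ballx (f 0) _ e2).
  exists (Num.min (r / 2) 1); first by rewrite lt_min divr_gt0//= ltr01 ge_min lexx orbT.
  move=> t /andP[t0]; rewrite le_min => /andP[tr _]; apply: rf.
  rewrite -ball_normE /= sub0r normrN ger0_norm//.
  by apply: le_lt_trans tr _; rewrite ltr_pdivrMr// ltr_pMr// ltr1n.
have [d d0 db] : exists2 d : R, 0 < d & ball (f 0) d `<=` ~` piece a 1.
  have : nbhs (f 0) (~` piece a 1).
    apply: open_nbhs_nbhs; split; first by rewrite openC; exact: piece_closed.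
    move=> [t /=]; rewrite in_itv /= => /andP[ta t1] ft0.
    have : t = 0 by apply: fI => //; lra.
    by lra.
  by move=> /nbhs_ballP[d /= d0 db]; exists d.
pose S : set 'rV[R]_n := [set z | `|f 0 - z| = e / 2].
have cN := @dist_continuous R 'rV[R]_n (f 0).
have cS : closed S.
  rewrite (_ : S = (fun z => `|f 0 - z|) @^-1` [set e / 2])//.
  by have /continuous_closedP := cN; apply; exact: closed_eq.
have a01 : 0 <= a by exact: ltW.
exists (Num.min d (e / 2)); first by rewrite lt_min d0.
move=> x y dx dy Nx Ny.
have xS : ball (f 0) (e / 2) x by apply: le_ball dx; rewrite ge_min lexx orbT.
have sub a' b : 0 <= a' -> b <= 1 -> piece a' b `<=` f @` `[0, 1].
  move=> a'0 b1 _ [t /= + <-]; rewrite in_itv /= => /andP[ta tb].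
  by exists t => //=; rewrite in_itv /= (le_trans a'0 ta) (le_trans tb b1).
have : conn (~` (piece 0 a `|` (piece a 1 `|` S))) x y.
  have [r Ar] := @compact_ball (f @` `[0, 1]) (f a) (@piece_compact _ _).
  have [r' Ar'] : exists r', S `<=` ball (f a) r'.
    exists (`|f a - f 0| + e / 2 + 1) => z /= Sz; rewrite -ball_normE /=.
    by rewrite ltr_pwDr// -Sz ler_distD.
  apply: (@conn_setU_point _ _ _ _ (f a) _ _ (Num.max r r')).
  - exact: piece_closed.
  - by apply: closedU => //; exact: piece_closed.
  - by exists a => //=; rewrite in_itv /= lexx a01.
  - by left; exists a => //=; rewrite in_itv /= lexx a1.
  - move=> z [z1 [z2|Sz]]; first by apply: (@pieceI 0 a 1); rewrite ?lexx ?a01 ?a1.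
    case: z1 Sz => t /=; rewrite in_itv /= => ta <-; have := fa t ta.
    by rewrite -ball_normE /S /= => /[swap] ->; rewrite ltxx.
  - move=> z [|[|]].
    + by move=> /(sub _ _ (lexx _) a1)/Ar; apply: le_ball; rewrite le_max lexx.
    + by move=> /(sub _ _ a01 (lexx _))/Ar; apply: le_ball; rewrite le_max lexx.
    + by move=> /Ar'; apply: le_ball; rewrite le_max lexx orbT.
  - by apply: conn_sub (arc_conn Nx Ny) => z Nz /(sub _ _ (lexx _) a1).
  - apply: conn_segment => t t01.
    have := ball_segment dx dy t01; set z := x + _ => zd [/db|].
      by apply; apply: le_ball zd; rewrite ge_min lexx.
    move: zd; rewrite -ball_normE /S /= lt_min => /andP[_] /[swap] ->.
    by rewrite ltxx.
move=> [l cl [l0 l1 lO]]; exists l => //; split => // t t01.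
have /not_orP[lA /not_orP[lB lS]] := lO t t01.
split; last first.
  change (~ piece 0 1 (l t)); rewrite (pieceU a01 a1).
  by case.
apply: contrapT => Nt.
have te : e / 2 <= `|f 0 - l t|.
  rewrite leNgt; apply/negP => h; apply: Nt; rewrite -ball_normE /=.
  by apply: lt_trans h _; rewrite ltr_pdivrMr// ltr_pMr// ltr1n.
(* A path that starts inside the sphere and leaves the larger ball is somewhere at distance [e / 2],
   whereas it avoids [S]. *)
have [| | |c] := @IVT R (fun t => `|f 0 - l t|) 0 t (e / 2).
- by case/andP: t01.
- apply: continuous_subspaceT => s.
  by apply: (@continuous_comp _ _ _ l (fun z => `|f 0 - z|)); [exact: cl|exact: cN].
- rewrite l0; move: xS; rewrite -ball_normE /= => xS.
  by rewrite ge_min (ltW xS) /= le_max te orbT.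
rewrite in_itv /= => /andP[c0 ct] lc.
have := lO c; rewrite c0 (le_trans ct) ?(andP t01).2//= => /(_ isT).
by apply; right; right.
Qed.

(** If a ball lay in the arc, [g] would start from 0 on both halves of a short segment through
    [f 0]. By the intermediate value theorem the smaller of its two end values would be taken on the
    opposite half too, so two distinct points would have the same parameter. *)
Lemma arc_endpoint_not_interior (g : 'rV[R]_n -> R) (e : R) :
  {within f @` `[0, 1], continuous g} ->
  (forall t, 0 <= t <= 1 -> g (f t) = t) -> 0 < e ->
  exists2 x, ball (f 0) e x & ~ (f @` `[0, 1]) x.
Proof.
move=> cg gf e0; apply: contrapT => /forall2NP h.
have bf : ball (f 0) e `<=` f @` `[0, 1].
  by move=> z ze; case: (h z) => [|/contrapT].
have i0 : 0 <= (0 : R) <= 1 by rewrite lexx ler01.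
pose v : 'rV[R]_n := const_mx (e / 2).
have n0 : (0 < n)%N by exact: ltn_trans hn.
have vE (s : R) (w : 'rV[R]_n) : 0 <= s <= 1 -> w = v \/ w = - v ->
    ball (f 0) e (f 0 + s *: w).
  move=> /andP[s0 s1] wv; split => // i j; rewrite -ball_normE /= !mxE.
  rewrite opprD addrA subrr add0r normrN normrM ger0_norm//.
  have -> : `|w i j| = e / 2.
    by case: wv => ->; rewrite !mxE ?normrN ger0_norm// ltW// divr_gt0.
  apply: (@le_lt_trans _ _ (e / 2)); first by rewrite ler_piMl// ltW// divr_gt0.
  by rewrite ltr_pdivrMr// ltr_pMr// ltr1n.
have reach w t : w = v \/ w = - v -> 0 <= t <= g (f 0 + w) ->
    exists2 s : R, 0 <= s <= 1 & f 0 + s *: w = f t.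
  move=> wv /andP[t0 tw].
  have [| | |s] := @IVT R (fun s => g (f 0 + s *: w)) 0 1 t.
  - exact: ler01.
  - apply: continuous_in_subspaceT => s; rewrite inE /= in_itv /= => s01.
    have cb : {in (ball (f 0) e : set 'rV[R]_n), continuous g}.
      rewrite -continuous_open_subspace; last exact: ball_open.
      exact: continuous_subspaceW bf cg.
    apply: (@continuous_cvg _ _ _ _ _ (fun s => f 0 + s *: w) g); last exact: line_continuous.
    by apply: cb; rewrite inE; exact: vE.
  - rewrite scale0r addr0 scale1r gf// ge_min t0 /= le_max tw orbT//.
  rewrite in_itv /= => s01 gt; exists s => //.
  have [u /= + fu] := bf _ (vE s w s01 wv); rewrite in_itv /= => u01.
  by rewrite -fu; congr f; rewrite -gt -fu gf.
have i1 : 0 <= (1 : R) <= 1 by rewrite lexx ler01.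
have key w : w = v \/ w = - v -> g (f 0 + w) <= g (f 0 - w) -> False.
  move=> wv gw.
  have wv' : - w = v \/ - w = - v by case: wv => ->; [right|left; rewrite opprK].
  have [u /= + fu] := bf _ (vE 1 w i1 wv); rewrite in_itv /= => u01.
  rewrite scale1r in fu.
  have [|s /andP[s0 _]] := reach (- w) u wv'.
    by rewrite (andP u01).1 /= -[leLHS]gf// fu.
  rewrite fu => /addrI /rowP /(_ (Ordinal n0)); rewrite !mxE.
  have : w 0 (Ordinal n0) != 0.
    by case: wv => ->; rewrite !mxE ?oppr_eq0 gt_eqF// divr_gt0.
  move=> /negP w0 sw; apply: w0; set x := w 0 _ in sw *.
  have /eqP : (1 + s) * x = 0 by rewrite mulrDl mul1r -{1}sw; ring.
  by rewrite mulf_eq0 => /orP[/eqP s1|//]; lra.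
have [gv|gv] := leP (g (f 0 + v)) (g (f 0 - v)); first by apply: (key v) => //; left.
by apply: (key (- v)); [right|rewrite opprK ltW].
Qed.

End Arc.

(** * Simple chains of convex sets *)

(** This is convexity. *)
Definition segment_closed (R : realType) (V : normedModType R) (D : set V) :=
  forall x y, D x -> D y -> seg_in D x y.

Lemma conn_chain (R : realType) (V : normedModType R) (G : set V) (x y : V)
    (P : set (set V)) :
  (forall z, G z -> exists2 D, P D & nbhs z D) -> conn G x y ->
  exists N (D : nat -> set V), [/\ forall i, P (D i), D 0%N x, D N y &
    forall i, D i `&` D i.+1 !=set0].
Proof.
move=> GP [l cl [l0 l1 lG]].
have [t|e e0 H] := @lebesgue_number R R `[0, 1]
    [set E | exists2 D, P D & E `<=` l @^-1` D] (@segment_compact _ _ _).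
  rewrite /= in_itv /= => /lG/GP[D PD Dl].
  by exists (l @^-1` D); [exists D|exact: cl].
have [N Ne] : exists N, N.+1%:R^-1 < e.
  by have [N _ /(_ N (leqnn _))] := near_infty_natSinv_lt (PosNum e0); exists N.
have {}H i : (i <= N.+1)%N -> exists D, [/\ P D, D (l (node N i)) & D (l (node N i.+1))].
  move=> iN; have [|E [D PD ED] iE] := H (node N i); first by rewrite /= in_itv /= node01.
  by exists D; split => //; apply: (ED); apply: iE; [exact: ballxx|exact: node_ball].
(* Capping the index turns the finite chain into a sequence that repeats its last member, so the
   intersection clause needs no bound. *)
have [D HD] := choice (fun i => H (minn i N.+1) (geq_minr _ _)).
exists N.+1, D; split => [i|||i].
- by have [] := HD i.
- by have [_] := HD 0%N; rewrite min0n node0 l0.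
- by have [_] := HD N.+1; rewrite minnn nodeN l1.
- have [iN|Ni] := ltnP i N.+1.
    exists (l (node N i.+1)); have [_ _] := HD i; have [_] := HD i.+1.
    by rewrite (minn_idPl iN) (minn_idPl (ltnW iN)).
  exists (l (node N N.+1)); have [_] := HD i; have [_] := HD i.+1.
  by rewrite (minn_idPr Ni) (minn_idPr (leqW Ni)).
Qed.

(** A state [(k, j)] designates set [j] of chain [k]. At the end of a chain the next one starts, and
    the two sets share [z k.+1]. [lev] remembers [k], which later measures the closeness to an
    endpoint. *)
Lemma concat_chains (T : Type) (P : nat -> set (set T)) (z : nat -> T) :
  (forall k, exists N (D : nat -> set T), [/\ forall i, P k (D i),
    D 0%N (z k), D N (z k.+1) & forall i, D i `&` D i.+1 !=set0]) ->
  exists (E : nat -> set T) (lev : nat -> nat), [/\ forall i, P (lev i) (E i),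
    forall K, exists i0, forall i, (i0 <= i)%N -> (K <= lev i)%N,
    E 0%N (z 0%N) & forall i, E i `&` E i.+1 !=set0].
Proof.
move=> /choice[N /choice[D HD]].
pose next (u : nat * nat) := if (u.2 < N u.1)%N then (u.1, u.2.+1) else (u.1.+1, 0%N).
pose st i := iter i next (0%N, 0%N).
have stS i : st i.+1 = next (st i) by [].
have stN i : ((st i).2 <= N (st i).1)%N.
  by elim: i => [//|i IH]; rewrite stS /next; case: ifP.
exists (fun i => D (st i).1 (st i).2), (fun i => (st i).1); split.
- by move=> i; have [] := HD (st i).1.
- have mono i j : (i <= j)%N -> ((st i).1 <= (st j).1)%N.
    move=> /subnK <-; elim: (j - i)%N => [//|k IH]; rewrite addSn stS /next.
    by case: ifP => _ //=; exact: leqW.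
  have run i k j : st i = (k, 0%N) -> (j <= N k)%N -> st (j + i)%N = (k, j).
    move=> ik; elim: j => [//|j IH jN]; rewrite addSn stS IH /next /= ?jN//.
    exact: ltnW.
  have reach k : exists i, st i = (k, 0%N).
    elim: k => [|k [i ik]]; first by exists 0%N.
    by exists (N k + i).+1; rewrite stS (run _ _ _ ik)// /next /= ltnn.
  by move=> K; have [i iK] := reach K; exists i => j /mono; rewrite iK.
- by have [] := HD 0%N.
- move=> i; have [_ _ DN DD] := HD (st i).1; rewrite stS /next.
  case: ltnP => [_|Ni] /=; first exact: DD.
  exists (z (st i).1.+1); have [_ D0 _ _] := HD (st i).1.+1; split => //.
  by have -> : (st i).2 = N (st i).1 by apply/eqP; rewrite eqn_leq stN.
Qed.

(* Jump each time to the last set that meets the current one. *)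
Lemma simple_subchain (T : Type) (E : nat -> set T) :
  (forall i, E i `&` E i.+1 !=set0) ->
  (forall i, exists m, forall j, (m <= j)%N -> E i `&` E j = set0) ->
  exists f : nat -> nat, [/\ f 0%N = 0%N, forall i, (f i < f i.+1)%N,
    forall i, E (f i) `&` E (f i.+1) !=set0 &
    forall i j, (i.+2 <= j)%N -> E (f i) `&` E (f j) = set0].
Proof.
move=> EE Efin.
have /choice[next Hnext] i : exists k, [/\ (i < k)%N, E i `&` E k !=set0 &
    forall j, (k < j)%N -> E i `&` E j = set0].
  have [m Hm] := Efin i.
  have ub j : `[< E i `&` E j !=set0 >] -> (j <= m)%N.
    move=> /asboolP [x ijx]; rewrite leqNgt; apply/negP => /ltnW/Hm mj.
    by rewrite mj in ijx.
  have ex : exists j, `[< E i `&` E j !=set0 >] by exists i.+1; apply/asboolP.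
  case: (ex_maxnP ex ub) => k /asboolP ik kmax; exists k; split => //.
    by apply: kmax; apply/asboolP.
  move=> j kj; apply/eqP/negPn/negP => /set0P/asboolP/kmax.
  by rewrite leqNgt kj.
pose f i := iter i next 0%N.
have fS i : f i.+1 = next (f i) by [].
have flt i : (f i < f i.+1)%N by rewrite fS; have [] := Hnext (f i).
have fmono : {mono f : i j / (i < j)%N}.
  by apply: leqW_mono; apply: leq_mono; exact: (homo_ltn ltn_trans).
exists f; split => // [i|i j ij].
  by rewrite fS; have [] := Hnext (f i).
by have [_ _] := Hnext (f i); apply; rewrite -fS fmono.
Qed.

(** [Negz m] is -(m+1), so [E 0] stands at index -1, next to [F 0] at index 0, and [E] runs
    backwards. *)
Definition two_sided (T : Type) (E F : nat -> T) (k : int) : T :=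
  match k with Posz m => F m | Negz m => E m end.

Lemma max_nat (P : nat -> Prop) (m : nat) : (exists i, P i) ->
  (forall i, P i -> (i <= m)%N) ->
  exists2 i, P i & forall j, (i < j)%N -> ~ P j.
Proof.
move=> [i Pi] ub.
have ub' j : `[< P j >] -> (j <= m)%N by move=> /asboolP/ub.
have ex : exists j, `[< P j >] by exists i; apply/asboolP.
case: (ex_maxnP ex ub') => k /asboolP Pk kmax; exists k => // j kj /asboolP/kmax.
by rewrite leqNgt kj.
Qed.

(** Thinning each sequence separately leaves unwanted meetings between the two. They are removed by
    cutting at the last [F j0] that meets the thinned [E], then at the last thinned [E] that meets
    [F j0]; the rest of [F] is thinned only afterwards, from [j0] on, so that this link survives. *)
Lemma two_sided_chain (T : Type) (E F : nat -> set T) :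
  (forall i, E i `&` E i.+1 !=set0) -> (forall i, F i `&` F i.+1 !=set0) ->
  E 0%N `&` F 0%N !=set0 ->
  (forall i, exists m, forall j, (m <= j)%N -> E i `&` E j = set0) ->
  (forall i, exists m, forall j, (m <= j)%N -> F i `&` F j = set0) ->
  (exists m, forall j, (m <= j)%N -> forall i, E i `&` F j = set0) ->
  (forall j, exists m, forall i, (m <= i)%N -> E i `&` F j = set0) ->
  exists f g : nat -> nat, [/\ forall i, (i <= f i)%N, forall i, (i <= g i)%N,
    forall k : int, two_sided (E \o f) (F \o g) k `&`
                    two_sided (E \o f) (F \o g) (k + 1) !=set0 &
    forall i j : int, i + 2 <= j -> two_sided (E \o f) (F \o g) i `&`
                    two_sided (E \o f) (F \o g) j = set0].
Proof.
move=> EE FF EF Efin Ffin [mF HmF] EFfin.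
have nS (h : nat -> nat) : (forall i, (h i < h i.+1)%N) -> forall i, (i <= h i)%N.
  by move=> hS; elim=> [//|i IH]; exact: leq_ltn_trans (hS i).
have [f [f0 fS fE fD]] := simple_subchain EE Efin.
have meet0 (A B : set T) : ~ (A `&` B !=set0) -> A `&` B = set0.
  by move=> h; apply/eqP/negPn/negP => /set0P.
have [|j|j0 [k1 k1j] j0max] :=
    @max_nat (fun j => exists k, E (f k) `&` F j !=set0) mF.
- by exists 0%N, 0%N; rewrite f0.
- move=> [k kj]; rewrite leqNgt; apply/negP => /ltnW/HmF/(_ (f k)) h.
  by move: kj; rewrite h => -[].
have [m Hm] := EFfin j0.
have [|k|k0 k0j k0max] := @max_nat (fun k => E (f k) `&` F j0 !=set0) m.
- by exists k1.
- move=> kj; rewrite leqNgt; apply/negP => /ltnW mk.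
  by move: kj; rewrite Hm => [[//]|]; exact: leq_trans (nS f fS k).
have [i|i|g [g0 gS gF gD]] := @simple_subchain T (fun j => F (j0 + j)%N).
- by rewrite addnS; exact: FF.
- have [m' Hm'] := Ffin (j0 + i)%N; exists m' => j mj; apply: Hm'.
  exact: leq_trans mj (leq_addl _ _).
have gmono : {mono g : i j / (i < j)%N}.
  by apply: leqW_mono; apply: leq_mono; exact: (homo_ltn ltn_trans).
exists (fun i => f (k0 + i)%N), (fun i => (j0 + g i)%N); split.
- by move=> i; apply: leq_trans (nS f fS _); exact: leq_addl.
- by move=> i; apply: leq_trans (nS g gS _) _; exact: leq_addl.
- move=> [k|[|k]].
  + by rewrite -PoszD addn1; exact: gF.
  + by rewrite NegzE addNr /= addn0 g0 addn0.
  + rewrite (_ : Negz k.+1 + 1 = Negz k); last by rewrite !NegzE; lia.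
    by rewrite /= addnS setIC; exact: fE.
- move=> [i|i] [j|j] ij /=.
  + by apply: gD; lia.
  + by exfalso; lia.
  + apply: meet0 => EFij; have [j0'|j1] := posnP j.
      move: EFij; rewrite j0' g0 addn0; apply: k0max.
      by rewrite -[ltnLHS]addn0 ltn_add2l; lia.
    apply: (j0max (j0 + g j)%N); last by exists (k0 + i)%N.
    by rewrite -[ltnLHS]addn0 ltn_add2l -g0 gmono.
  + by rewrite setIC; apply: fD; lia.
Qed.

Section ChainBetween.
Context {R : realType} {V : normedModType R}.
Variables (p q : V).

Definition tends_to (E : nat -> set V) (c : V) := forall r : R, 0 < r ->
  exists m, forall i, (m <= i)%N -> E i `<=` ball c r.

Definition away (c : V) (D : set V) :=
  exists2 r : R, 0 < r & D `&` ball c r = set0.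

Lemma away_tends_to (E : nat -> set V) (c : V) (D : set V) :
  away c D -> tends_to E c -> exists m, forall i, (m <= i)%N -> D `&` E i = set0.
Proof.
move=> [r r0 Dr] /(_ r r0)[m Em]; exists m => i /Em Ei.
by rewrite -subset0 -Dr => z [Dz /Ei].
Qed.

(** An infinite union of sets away from [q] may well approach [q]; here all but finitely many of
    them are within half of the distance from [p] to [q] of the point [p]. *)
Lemma tends_to_away (E : nat -> set V) :
  p != q -> tends_to E p -> (forall i, away q (E i)) -> away q (\bigcup_i E i).
Proof.
move=> pq Ep Eq; have r0 : 0 < `|p - q| / 2 by rewrite divr_gt0// normr_gt0 subr_eq0.
have [m Hm] := Ep _ r0.
have [r r1 Hr] : exists2 r : R, 0 < r &
    forall i, (i < m)%N -> E i `&` ball q r = set0.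
  elim: m {Hm} => [|m [r r1 Hr]]; first by exists 1.
  have [s s0 Hs] := Eq m; exists (Num.min r s); first by rewrite lt_min r1.
  move=> i; rewrite ltnS leq_eqVlt => /orP[/eqP ->|im].
    rewrite -subset0 -Hs => z [Ez zb]; split => //.
    by apply: le_ball zb; rewrite ge_min lexx orbT.
  rewrite -subset0 -(Hr i im) => z [Ez zb]; split => //.
  by apply: le_ball zb; rewrite ge_min lexx.
exists (Num.min r (`|p - q| / 2)); first by rewrite lt_min r1.
rewrite -subset0 => z [[i _ Ei] zb]; have [im|mi] := ltnP i m.
  rewrite -(Hr i im); split => //; apply: le_ball zb.
  by rewrite ge_min lexx.
have := Hm i mi z Ei; rewrite -ball_normE /= => pz.
have : ball q (`|p - q| / 2) z by apply: le_ball zb; rewrite ge_min lexx orbT.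
rewrite -ball_normE /= distrC => zq.
have := ler_distD z p q; rewrite leNgt => /negP; apply.
by rewrite [ltRHS]splitr ltrD.
Qed.

Lemma chain_between (G : set V) (x y : nat -> V) (d : nat -> R) :
  p != q -> open G -> ~ G p -> ~ G q -> conn G (x 0%N) (y 0%N) ->
  (forall r, 0 < r -> exists m, forall i, (m <= i)%N -> d i <= r) ->
  (forall k, conn (G `&` ball p (d k)) (x k) (x k.+1)) ->
  (forall k, conn (G `&` ball q (d k)) (y k) (y k.+1)) ->
  exists C : int -> set V, [/\
    forall k, [/\ open (C k), segment_closed (C k) & C k `<=` G],
    forall k, C k `&` C (k + 1) !=set0,
    forall i j, i + 2 <= j -> C i `&` C j = set0,
    forall r : R, 0 < r -> exists m : nat, forall k : int, m%:Z <= k -> C k `<=` ball q r &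
    forall r : R, 0 < r -> exists m : nat, forall k : int, k <= - m%:Z -> C k `<=` ball p r].
Proof.
move=> pq oG Gp Gq xy dr xx yy.
(* A set away from both endpoints meets only finitely many sets of a sequence that tends to one of
   them, as [two_sided_chain] demands. *)
pose good (H : set V) : set (set V) := [set D | [/\ open D, segment_closed D,
  D `<=` G `&` H, away p D & away q D]].
have goodP H : open H -> forall z, (G `&` H) z -> exists2 D, good H D & nbhs z D.
  move=> oH z [Gz Hz].
  have /nbhs_ballP[r /= r0 rGH] : nbhs z (G `&` H).
    by apply: open_nbhs_nbhs; split=> //; exact: openI.
  have zp : 0 < `|z - p| / 2.
    by rewrite divr_gt0// normr_gt0 subr_eq0; apply/eqP => zp; apply: Gp; rewrite -zp.
  have zq : 0 < `|z - q| / 2.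
    by rewrite divr_gt0// normr_gt0 subr_eq0; apply/eqP => zq; apply: Gq; rewrite -zq.
  pose s := Num.min r (Num.min (`|z - p| / 2) (`|z - q| / 2)).
  have s0 : 0 < s by rewrite !lt_min r0 zp.
  have aw c : s <= `|z - c| / 2 -> away c (ball z s).
    move=> sc; exists s => //; rewrite -subset0 => w; rewrite -!ball_normE /= => -[zw cw].
    have := ler_distD w z c; rewrite leNgt => /negP; apply.
    rewrite [ltRHS]splitr ltrD//; first exact: lt_le_trans sc.
    by rewrite distrC; exact: lt_le_trans sc.
  exists (ball z s); last exact: nbhsx_ballx.
  split; first exact: ball_open.
  - by move=> u v; exact: ball_segment.
  - by apply: subset_trans rGH; apply: le_ball; rewrite ge_min lexx.
  - by apply: aw; rewrite !ge_min lexx orbT.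
  - by apply: aw; rewrite !ge_min lexx !orbT.
have chainP (H : nat -> set V) (z : nat -> V) : (forall k, open (H k)) ->
    (forall k, conn (G `&` H k) (z k) (z k.+1)) ->
    exists (E : nat -> set V) (lev : nat -> nat), [/\ forall i, good (H (lev i)) (E i),
    forall K, exists i0, forall i, (i0 <= i)%N -> (K <= lev i)%N,
    E 0%N (z 0%N) & forall i, E i `&` E i.+1 !=set0].
  move=> oH zz; apply: (@concat_chains _ (fun k => good (H k))) => k.
  apply: conn_chain (zz k); exact: goodP.
have limP (H : nat -> set V) c (E : nat -> set V) (lev : nat -> nat) :
    (forall i, good (H (lev i)) (E i)) ->
    (forall r, 0 < r -> exists m, forall i, (m <= i)%N -> H i `<=` ball c r) ->
    (forall K, exists i0, forall i, (i0 <= i)%N -> (K <= lev i)%N) -> tends_to E c.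
  move=> Eg Hc lv r r0; have [m Hm] := Hc r r0; have [i0 Hi] := lv m.
  exists i0 => i /Hi/Hm mi; have [_ _ Ei _ _] := Eg i.
  by move=> z /Ei[_ /mi].
have [E [lE [Eg El E0 EE]]] := chainP (fun k => ball p (d k)) x (fun=> ball_open _ _) xx.
(* The shift by one makes room for the passage from [x 0] to [y 0], which has no size constraint.
   Both sides thus start at [x 0], where they are linked. *)
pose HF k := if k is k'.+1 then ball q (d k') else setT.
pose zF k := if k is k'.+1 then y k' else x 0%N.
have [k|k|F [lF [Fg Fl F0 FF]]] := chainP HF zF.
- by case: k => [|k]; [exact: openT|exact: ball_open].
- by case: k => [|k] /=; [rewrite setIT|].
have Ep : tends_to E p.
  apply: limP Eg _ El => r r0; have [m Hm] := dr r r0.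
  by exists m => i /Hm; exact: le_ball.
have Fq : tends_to F q.
  apply: limP Fg _ Fl => r r0; have [m Hm] := dr r r0.
  by exists m.+1 => -[//|i] /Hm; exact: le_ball.
have qp : q != p by rewrite eq_sym.
have aE i : away p (E i) /\ away q (E i) by have [_ _ _] := Eg i.
have aF i : away p (F i) /\ away q (F i) by have [_ _ _] := Fg i.
have [| | |i|i| |j|f [g [fi gi CC CD]]] := @two_sided_chain V E F.
- exact: EE.
- exact: FF.
- by exists (x 0%N).
- exact: away_tends_to (aE i).1 Ep.
- exact: away_tends_to (aF i).2 Fq.
- have [m Hm] := away_tends_to (tends_to_away pq Ep (fun i => (aE i).2)) Fq.
  exists m => j mj i; rewrite -subset0 -(Hm j mj) => z [Ez Fz].
  by split => //; exists i.
- have [m Hm] := away_tends_to (aF j).1 Ep.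
  by exists m => i /Hm; rewrite setIC.
exists (two_sided (E \o f) (F \o g)); split => //.
- move=> [k|k] /=.
    by have [h1 h2 h3 _ _] := Fg (g k); split => //; apply: subset_trans h3 _ => z [].
  by have [h1 h2 h3 _ _] := Eg (f k); split => //; apply: subset_trans h3 _ => z [].
- move=> r /Fq[m Hm]; exists m => -[k|k] // mk; apply: Hm.
  exact: leq_trans mk (gi k).
- move=> r /Ep[m Hm]; exists m.+1 => -[k|k] mk; first by exfalso; lia.
  by apply: Hm; apply: leq_trans (fi k); lia.
Qed.

End ChainBetween.

(** * Flat functions and smoothness *)

Lemma is_deriveZl (R : realType) (V : normedModType R) (a : R -> R) (da x : R)
    (u : V) : is_derive x 1 a da -> is_derive x 1 (fun t => a t *: u) (da *: u).
Proof.
move=> [ax <-].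
have lim_u : h^-1 *: ((((fun t => a t *: u) \o shift x) (h *: 1)) - a x *: u)
    @[h --> 0^'] --> 'D_1 a x *: u.
  have -> : (fun h => h^-1 *: ((((fun t => a t *: u) \o shift x) (h *: 1)) - a x *: u))
    = (fun h : R => (h^-1 *: ((a \o shift x) (h *: 1) - a x)) *: u).
    by apply/funext => h; rewrite /= -scalerBl scalerA.
  exact: cvgZr_tmp.
split; first by apply/cvg_ex; exists ('D_1 a x *: u).
exact: (@cvg_lim _ (@norm_hausdorff _ V)).
Qed.

(* [flat m] is [x^-m * exp (-1/x)] extended by 0; these functions are closed
   under differentiation up to linear combination. *)
Definition flat (R : realType) (m : nat) (x : R) : R :=
  if x <= 0 then 0 else x^-1 ^+ m * expR (- x^-1).

Lemma flat0 (R : realType) m (x : R) : x <= 0 -> flat m x = 0.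
Proof. by rewrite /flat => ->. Qed.

Lemma flatE (R : realType) m (x : R) :
  0 < x -> flat m x = x^-1 ^+ m * expR (- x^-1).
Proof. by rewrite /flat leNgt => ->. Qed.

Lemma flat_gt0 (R : realType) m (x : R) : 0 < x -> 0 < flat m x.
Proof. by move=> x0; rewrite flatE// mulr_gt0 ?expR_gt0// exprn_gt0// invr_gt0. Qed.

Lemma flat_ge0 (R : realType) m (x : R) : 0 <= flat m x.
Proof. by have [x0|x0] := leP x 0; [rewrite flat0|exact/ltW/flat_gt0]. Qed.

(** The term of degree [m.+1] in the exponential series at [x^-1] dominates [x^-1 ^+ m] and leaves a
    factor [x] to spare. *)
Lemma flat_le (R : realType) m (x : R) : 0 <= x -> flat m x <= m.+1`!%:R * x.
Proof.
rewrite le_eqVlt => /orP[/eqP <-|x0]; first by rewrite flat0 ?mulr0.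
rewrite flatE// expRN; have y0 : 0 < x^-1 by rewrite invr_gt0.
rewrite ler_pdivrMr ?expR_gt0//.
have := @expR_ge1Dxn R x^-1 m (ltW y0) => h.
apply: (@le_trans _ _ (m.+1`!%:R * x * (x^-1 ^+ m.+1 / m.+1`!%:R))).
  rewrite le_eqVlt exprS mulrA; apply/orP; left; apply/eqP.
  by field; rewrite gt_eqF ?ltr0n ?fact_gt0//= gt_eqF.
rewrite ler_pM2l; last by rewrite mulr_gt0// ltr0n fact_gt0.
by apply: le_trans h; rewrite lerDr.
Qed.

(** At 0 the right difference quotient of [flat m] is [flat m.+1], which [flat_le] sends to 0; the
    left one is 0. For positive [x] this is the product rule. *)
Lemma is_derive_flat (R : realType) m (x : R) :
  is_derive x 1 (flat m) (flat m.+2 x - m%:R * flat m.+1 x).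
Proof.
have [x0|x0|->] := ltgtP x 0.
- rewrite !flat0 ?(ltW x0)// mulr0 subr0.
  apply: (near_eq_is_derive _ (is_derive_cst (0 : R) x 1)).
  by near=> y; rewrite /= flat0// ltW//; near: y; exact: lt_nbhsl.
- suff dF : is_derive x 1 (fun y => y^-1 ^+ m * expR (- y^-1))
      (flat m.+2 x - m%:R * flat m.+1 x).
    apply: (near_eq_is_derive _ dF).
    by near=> y; rewrite flatE//; near: y; exact: lt_nbhsr.
  have xn0 : x != 0 by rewrite gt_eqF.
  have dV : is_derive x 1 (fun y : R => y^-1) (- x^-1 ^+ 2).
    have := @is_deriveV R id x 1 1 xn0 (is_derive_id _ _).
    move=> dV; apply: (is_derive_eq dV).
    by rewrite /GRing.scale /= mulr1 exprVn.
  have dX : is_derive x 1 (fun y : R => y^-1 ^+ m) (m%:R * x^-1 ^+ m.-1 * - x^-1 ^+ 2).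
    by have := @is_deriveX _ _ _ m _ _ _ dV; rewrite exprfctE.
  have dE : is_derive x 1 (fun y : R => expR (- y^-1)) (expR (- x^-1) * x^-1 ^+ 2).
    have := @is_derive1_comp R expR (fun y => - y^-1) x _ _ (is_derive_expR _)
      (@is_deriveN _ _ _ _ _ _ _ dV).
    by rewrite opprK.
  have := @is_deriveM _ _ _ _ _ _ _ _ dX dE.
  move=> dM; apply: (is_derive_eq dM); rewrite !flatE// /GRing.scale /=.
  case: m {dX dM} => [|m] /=; first by rewrite !expr0; ring.
  by rewrite !exprS; ring.
- rewrite !flat0// mulr0 subr0.
  have lim0 : h^-1 *: ((flat m \o shift 0) (h *: (1 : R)) - flat m (0 : R)) @[h --> 0^'] --> (0 : R).
    apply/cvgrPdist_lt => e e0 /=; near=> h.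
    rewrite sub0r normrN addr0 (flat0 m (lexx 0)) subr0 /GRing.scale /= mulr1.
    have hn0 : h != 0 by near: h; exact: nbhs_dnbhs_neq.
    have [h0|h0] := leP h 0; first by rewrite flat0// mulr0 normr0.
    have -> : h^-1 * flat m h = flat m.+1 h by rewrite !flatE// exprS mulrA.
    rewrite ger0_norm ?flat_ge0//; apply: le_lt_trans (flat_le _ (ltW h0)) _.
    rewrite mulrC -ltr_pdivlMr ?ltr0n ?fact_gt0//.
    rewrite -[ltLHS]ger0_norm ?(ltW h0)//.
    near: h; apply: dnbhs0_lt.
    by rewrite divr_gt0// ltr0n fact_gt0.
  split; first by apply/cvg_ex; exists 0.
  exact: (@cvg_lim _ (@norm_hausdorff _ R^o)).
Unshelve. all: by end_near. Qed.

(** A syntactic class that contains the derivatives of its members on [U]: derivability of every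
    order follows by induction, without formulas for higher derivatives. [U] is where denominators
    must not vanish. *)
Inductive elementary (R : realType) (U : set R) : (R -> R) -> Prop :=
| elementary_cst c : elementary U (fun=> c)
| elementary_id : elementary U id
| elementary_add f g : elementary U f -> elementary U g ->
    elementary U (fun x => f x + g x)
| elementary_mul f g : elementary U f -> elementary U g ->
    elementary U (fun x => f x * g x)
| elementary_inv f : elementary U f -> (forall x, U x -> f x != 0) ->
    elementary U (fun x => (f x)^-1)
| elementary_flat m f : elementary U f -> elementary U (fun x => flat m (f x)).

Lemma elementary_derive (R : realType) (U : set R) (f : R -> R) :
  elementary U f -> exists2 df, elementary U df &
    forall x, U x -> is_derive x 1 f (df x).
Proof.
elim=> [c||g h _ [dg eg Hg] _ [dh eh Hh]|g h fg [dg eg Hg] fh [dh eh Hh]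
  |g fg [dg eg Hg] g0|m g fg [dg eg Hg]].
- exists (fun=> 0); first exact: elementary_cst.
  by move=> x _; exact: is_derive_cst.
- exists (fun=> 1); first exact: elementary_cst.
  by move=> x _; exact: is_derive_id.
- exists (fun x => dg x + dh x); first exact: elementary_add.
  by move=> x Ux; exact: is_deriveD (Hg x Ux) (Hh x Ux).
- exists (fun x => g x * dh x + h x * dg x).
    by apply: elementary_add; exact: elementary_mul.
  by move=> x Ux; exact: is_deriveM (Hg x Ux) (Hh x Ux).
- exists (fun x => (- 1 * ((g x)^-1 * (g x)^-1)) * dg x).
    have eV := elementary_inv fg g0.
    by do !apply: elementary_mul => //; exact: elementary_cst.
  move=> x Ux; have := @is_deriveV R g x (dg x) 1 (g0 x Ux) (Hg x Ux).
  move=> dV; apply: (is_derive_eq dV).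
  by rewrite /GRing.scale /= mulN1r !mulNr expr2 invfM.
- exists (fun x => (flat m.+2 (g x) + - m%:R * flat m.+1 (g x)) * dg x).
    apply: elementary_mul => //; apply: elementary_add; first exact: elementary_flat.
    by apply: elementary_mul; [exact: elementary_cst|exact: elementary_flat].
  move=> x Ux; have := is_derive1_comp (is_derive_flat m (g x)) (Hg x Ux).
  by rewrite mulNr.
Qed.

Lemma derive1_near (R : realType) (V : normedModType R) (f g : R -> V) (x : R) :
  {near x, f =1 g} -> derive1 f x = derive1 g x.
Proof. by move=> fg; rewrite !derive1E; apply: near_eq_derive; rewrite ?oner_eq0. Qed.

(** Two scalar coefficients on fixed vectors are what a rounded corner needs, and differentiation
    keeps this form with [v] replaced by 0. Equality is local because the vectors change from corner
    to corner. *)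
Definition locally_elementary (R : realType) (V : normedModType R) (U : set R)
    (h : R -> V) := forall x, U x -> exists (a b : R -> R) (v u w : V),
  [/\ elementary U a, elementary U b &
     \forall y \near x, h y = v + a y *: u + b y *: w].

Lemma is_derive_combination (R : realType) (V : normedModType R) (a b : R -> R)
    (da db x : R) (v u w : V) : is_derive x 1 a da -> is_derive x 1 b db ->
  is_derive x 1 (fun y => v + a y *: u + b y *: w) (da *: u + db *: w).
Proof.
move=> ha hb; have := @is_deriveD R R V (fun y => v + a y *: u) (fun y => b y *: w) x 1 _ _
  (is_deriveD (is_derive_cst v x 1) (is_deriveZl u ha)) (is_deriveZl w hb).
by rewrite add0r.
Qed.

Lemma locally_elementary_derivable (R : realType) (V : normedModType R)
    (U : set R) (h : R -> V) : open U -> locally_elementary U h ->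
  locally_elementary U (derive1 h) /\ forall x, U x -> derivable h x 1.
Proof.
move=> oU hU; split => x Ux; have [a [b [v [u [w [ea eb hx]]]]]] := hU x Ux.
  have [da eda Ha] := elementary_derive ea; have [db edb Hb] := elementary_derive eb.
  exists da, db, 0, u, w; split => //.
  have Unear : \forall y \near x, U y by exact: open_nbhs_nbhs.
  near=> y; rewrite add0r.
  have -> : derive1 h y = derive1 (fun y => v + a y *: u + b y *: w) y.
    by apply: derive1_near; near: y; exact: (near_join hx).
  rewrite derive1E; apply: derive_val.
  by apply: is_derive_combination; [apply: Ha|apply: Hb]; near: y.
have [da _ Ha] := elementary_derive ea; have [db _ Hb] := elementary_derive eb.
suff : is_derive x 1 h (da x *: u + db x *: w) by case.
apply: (near_eq_is_derive _ (is_derive_combination v u w (Ha x Ux) (Hb x Ux))).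
by near=> y; rewrite (near hx y).
Unshelve. all: by end_near. Qed.

Lemma locally_elementary_smooth (R : realType) (V : normedModType R)
    (U : set R) (h : R -> V) : open U -> locally_elementary U h ->
  forall k x, U x -> derivable (derive1n k h) x 1.
Proof.
move=> oU hU k; suff : locally_elementary U (derive1n k h).
  by move=> /(locally_elementary_derivable oU)[].
by elim: k => [//|k /(locally_elementary_derivable oU)[]].
Qed.

Section SmoothStep.
Context {R : realType}.
Implicit Types s t : R.

Definition smooth_step s : R := flat 0 s / (flat 0 s + flat 0 (1 - s)).

Lemma smooth_step_den s : 0 < flat 0 s + flat 0 (1 - s).
Proof.
have [s0|s0] := leP s 0; last by rewrite ltr_pwDl ?flat_ge0 ?flat_gt0.
by rewrite ltr_wpDl ?flat_ge0// flat_gt0; lra.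
Qed.

Lemma smooth_step0 s : s <= 0 -> smooth_step s = 0.
Proof. by move=> s0; rewrite /smooth_step flat0 ?mul0r. Qed.

Lemma smooth_step1 s : 1 <= s -> smooth_step s = 1.
Proof.
move=> s1; have := smooth_step_den s; rewrite /smooth_step (@flat0 _ _ (1 - s)); last lra.
by rewrite addr0 => h; rewrite divff ?gt_eqF.
Qed.

Lemma smooth_stepC s : 1 - smooth_step s = smooth_step (1 - s).
Proof.
rewrite /smooth_step subKr [flat 0 (1 - s) + _]addrC.
have D0 := smooth_step_den s.
by rewrite -{1}(divff (lt0r_neq0 D0)) -mulrBl addrAC subrr add0r.
Qed.

Lemma smooth_step_ge0 s : 0 <= smooth_step s.
Proof. by rewrite divr_ge0 ?flat_ge0 ?ltW ?smooth_step_den. Qed.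

Lemma smooth_step_le1 s : smooth_step s <= 1.
Proof. by rewrite -subr_ge0 smooth_stepC smooth_step_ge0. Qed.

Lemma flat0_lt s t : s < t -> 0 < t -> flat 0 s < flat 0 t.
Proof.
move=> st t0; have [s0|s0] := leP s 0; first by rewrite flat0// flat_gt0.
by rewrite !flatE// !expr0 !mul1r ltr_expR ltrN2 ltf_pV2.
Qed.

Lemma smooth_step_lt s t : s < t -> 0 < t -> s < 1 -> smooth_step s < smooth_step t.
Proof.
move=> st t0 s1; rewrite /smooth_step.
have st' : flat 0 s < flat 0 t by exact: flat0_lt.
have ts' : flat 0 (1 - t) < flat 0 (1 - s) by apply: flat0_lt; lra.
(* Once denominators are cleared, [flat 0 s * flat 0 t] cancels, and the product of the two
   inequalities above remains. *)
rewrite ltr_pdivrMr ?smooth_step_den// mulrAC ltr_pdivlMr ?smooth_step_den//.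
by have := ltr_pM (flat_ge0 0 s) (flat_ge0 0 (1 - t)) st' ts'; lra.
Qed.

Lemma smooth_step_le s t : s <= t -> smooth_step s <= smooth_step t.
Proof.
rewrite le_eqVlt => /orP[/eqP -> //|st].
have [t0|t0] := leP t 0; first by rewrite !smooth_step0//; lra.
have [s1|s1] := leP 1 s; first by rewrite !smooth_step1//; lra.
exact/ltW/smooth_step_lt.
Qed.

Lemma smooth_step_derive : exists2 ds : R -> R,
  forall s, is_derive s 1 smooth_step (ds s) &
  (forall s, 0 <= ds s) /\ (forall s, 0 < s < 1 -> 0 < ds s).
Proof.
exists (fun s => (flat 2 s * flat 0 (1 - s) + flat 0 s * flat 2 (1 - s))
  / (flat 0 s + flat 0 (1 - s)) ^+ 2).
  move=> s; have D0 := smooth_step_den s.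
  have d1 := is_derive_flat 0 s.
  have d2 : is_derive s 1 (fun s => flat 0 (1 - s)) (- flat 2 (1 - s)).
    have dd : is_derive s 1 (fun s : R => 1 - s) (0 - 1).
      exact: is_deriveB (is_derive_cst _ _ _) (is_derive_id _ _).
    have := @is_derive1_comp R (flat 0) (fun s => 1 - s) s _ _ (is_derive_flat 0 _) dd.
    by rewrite mul0r subr0 sub0r mulrN1.
  have dD : is_derive s 1 (fun s => flat 0 s + flat 0 (1 - s)) _ := is_deriveD d1 d2.
  have d3 := @is_deriveV R _ s _ 1 (lt0r_neq0 D0) dD.
  have d4 := @is_deriveM _ _ _ _ _ _ _ _ d1 d3.
  apply: (is_derive_eq d4); rewrite /GRing.scale /=.
  by field; rewrite gt_eqF.
split => s.
  by rewrite divr_ge0 ?sqr_ge0// addr_ge0// mulr_ge0 ?flat_ge0.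
move=> /andP[s0 s1]; rewrite divr_gt0// ?exprn_gt0 ?smooth_step_den//.
by rewrite addr_gt0// mulr_gt0// flat_gt0// subr_gt0.
Qed.

(** [2 * r] is the argument bound in [ramp_small] and [ramp_large]; [1 / 4] keeps the windows of
    neighbouring corners apart. *)
Lemma smooth_step_small (e : R) : 0 < e ->
  exists2 r : R, 0 < r <= 1 / 4 & smooth_step (2 * r) <= e.
Proof.
move=> e0; have [ds Hs _] := smooth_step_derive.
have : {for 0, continuous smooth_step}.
  have [d _] := Hs 0.
  exact/differentiable_continuous/derivable1_diffP.
move=> /cvgrPdist_lt/(_ e e0)/nbhs_ballP[d /= d0 H].
exists (Num.min (d / 4) (1 / 4)).
  by rewrite lt_min divr_gt0//= divr_gt0// ge_min lexx orbT.
have /H : ball 0 d (2 * Num.min (d / 4) (1 / 4)).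
  rewrite -ball_normE /= sub0r normrN ger0_norm; last first.
    by rewrite mulr_ge0// le_min !divr_ge0// ltW.
  have : Num.min (d / 4) (1 / 4) <= d / 4 by rewrite ge_min lexx.
  by lra.
rewrite smooth_step0// sub0r normrN ger0_norm ?smooth_step_ge0//.
exact: ltW.
Qed.

Lemma elementary_smooth_step (U : set R) f :
  elementary U f -> elementary U (fun s => smooth_step (f s)).
Proof.
move=> ef; have e1 := elementary_flat 0 ef.
have e2 : elementary U (fun s => flat 0 (1 + -1 * f s)).
  apply: elementary_flat; apply: elementary_add; first exact: elementary_cst.
  by apply: elementary_mul => //; exact: elementary_cst.
have e3 : elementary U (fun s => (flat 0 (f s) + flat 0 (1 + -1 * f s))^-1).
  apply: elementary_inv; first exact: elementary_add.
  by move=> x _; rewrite mulN1r lt0r_neq0// smooth_step_den.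
have -> : (fun s => smooth_step (f s)) =
    (fun s => flat 0 (f s) * (flat 0 (f s) + flat 0 (1 + -1 * f s))^-1).
  by apply/funext => s; rewrite mulN1r.
exact: elementary_mul.
Qed.

End SmoothStep.

(** * Rounding the corners of a polygon *)

Lemma lerp_swap (R : pzRingType) (V : lmodType R) (b : R) (x y : V) :
  x + (1 - b) *: (y - x) = y + b *: (x - y).
Proof.
by rewrite scalerBl scale1r addrA addrCA subrr addr0 -scalerN opprB.
Qed.

Section RoundedPolygon.
Context {R : realType} {V : normedModType R}.
Variables (C : int -> set V) (v : int -> V) (r : int -> R).

(* With vertices [v k] and radii [r k <= 1/4], [ramp k] climbs from 0 to 1 on
   [k - r k, k + 1 + r (k + 1)] and carries the point from [v k] to
   [v (k + 1)]; near time [k] the ramps [k - 1] and [k] overlap, which rounds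
   the corner at [v k]. *)
Definition ramp (k : int) (t : R) : R :=
  smooth_step ((t - k%:~R + r k) / (1 + r k + r (k + 1))).

(** While [ramp k] is 0 this follows the edge from [v (k - 1)], and once [ramp (k - 1)] is 1 the
    edge to [v (k + 1)]; in between both edge vectors contribute. *)
Definition corner (k : int) (t : R) : V :=
  v k + (1 - ramp (k - 1) t) *: (v (k - 1) - v k) + ramp k t *: (v (k + 1) - v k).

Definition rounded (t : R) : V := corner (Num.floor (t + 1 / 2)) t.

Hypotheses (r0 : forall k, 0 < r k) (r4 : forall k, r k <= 1 / 4).

Let intp (k : int) : (k + 1)%:~R = k%:~R + 1 :> R. Proof. by rewrite intrD. Qed.
Let intm (k : int) : (k - 1)%:~R = k%:~R - 1 :> R. Proof. by rewrite intrB. Qed.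
Let len0 k : 0 < 1 + r k + r (k + 1). Proof. by have := r0 k; have := r0 (k + 1); lra. Qed.

Lemma ramp0 k t : t <= k%:~R - r k -> ramp k t = 0.
Proof. by move=> h; rewrite /ramp smooth_step0// pmulr_lle0 ?invr_gt0 ?len0//; lra. Qed.

Lemma ramp1 k t : k%:~R + 1 + r (k + 1) <= t -> ramp k t = 1.
Proof. by move=> h; rewrite /ramp smooth_step1// ler_pdivlMr ?len0//; lra. Qed.

Lemma ramp_le k s t : s <= t -> ramp k s <= ramp k t.
Proof.
by move=> st; rewrite smooth_step_le// ler_pM2r ?invr_gt0 ?len0//; lra.
Qed.

Lemma ramp_lt k s t : s < t -> k%:~R - r k < t -> s < k%:~R + 1 + r (k + 1) ->
  ramp k s < ramp k t.
Proof.
move=> st h1 h2; apply: smooth_step_lt.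
- by rewrite ltr_pM2r ?invr_gt0 ?len0//; lra.
- by rewrite divr_gt0 ?len0//; lra.
- by rewrite ltr_pdivrMr ?len0//; lra.
Qed.

(** The denominator is at least 1 and the numerator at most [2 * r k]. With [ramp_large], this keeps
    the rounded corner close to [v k]. *)
Lemma ramp_small k t : t <= k%:~R + r k -> ramp k t <= smooth_step (2 * r k).
Proof.
move=> h; apply: smooth_step_le; rewrite ler_pdivrMr ?len0//.
have : 0 <= r k * (r k + r (k + 1)) by rewrite mulr_ge0 ?addr_ge0 ?ltW.
by have := r0 k; lra.
Qed.

Lemma ramp_large k t : k%:~R - r k <= t -> 1 - ramp (k - 1) t <= smooth_step (2 * r k).
Proof.
move=> h; rewrite smooth_stepC; apply: smooth_step_le.
have L := len0 (k - 1); rewrite subrK in L *.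
rewrite lerBlDr -lerBlDl ler_pdivlMr// intm.
have : 0 <= r k * (r k + r (k - 1)) by rewrite mulr_ge0 ?addr_ge0 ?ltW.
by have := r0 k; lra.
Qed.

(** [rounded] uses the formula of the nearest vertex. If this is a neighbour of [k], the ramp of the
    preceding edge is complete and that of the following edge not begun, so both formulas describe
    the same edge in the same way. *)
Lemma rounded_corner k t :
  k%:~R - 1 + r (k - 1) <= t -> t <= k%:~R + 1 - r (k + 1) -> rounded t = corner k t.
Proof.
move=> h1 h2; rewrite /rounded; set j := Num.floor _.
have /andP[j1 j2] := floor_itv (t + 1 / 2); rewrite -/j intp in j1 j2.
have jk : j - 1 <= k.
  rewrite -ltzD1 -(ltr_int R) intm intp; have := r0 (k + 1); lra.
have kj : k - 1 <= j.
  rewrite -ltzD1 -(ltr_int R) intm intp; have := r0 (k - 1); lra.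
have [->//|[jE|jE]] : j = k \/ (j = k + 1 \/ j = k - 1) by lia.
- rewrite jE intp in j1 j2.
  rewrite jE /corner addrK (@ramp0 (k + 1)); last by rewrite intp; lra.
  rewrite (@ramp1 (k - 1)); last by rewrite intm !subrK; have := r4 k; lra.
  by rewrite subrr !scale0r !addr0 lerp_swap.
- rewrite jE intm in j1 j2.
  rewrite jE /corner subrK (@ramp0 k); last by have := r4 k; lra.
  rewrite (@ramp1 (k - 1 - 1)); last by rewrite !intm !subrK; have := r0 (k - 1); lra.
  by rewrite subrr !scale0r !addr0 lerp_swap.
Qed.

(** As radii are at most [1 / 4], the formula at [k] holds up to distance [3 / 4] from [k], which
    leaves a margin of [1 / 4] around the times nearest to [k]. *)
Lemma rounded_near t : exists k, k%:~R - 1 / 2 <= t < k%:~R + 1 / 2 /\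
  forall s, `|s - t| < 1 / 4 -> rounded s = corner k s.
Proof.
exists (Num.floor (t + 1 / 2)); set k := Num.floor _.
have /andP[k1 k2] := floor_itv (t + 1 / 2); rewrite -/k intp in k1 k2.
split; first by apply/andP; split; lra.
move=> s; rewrite ltr_norml => /andP[s1 s2].
by apply: rounded_corner; have := r4 (k - 1); have := r4 (k + 1); lra.
Qed.

Hypotheses (Cseg : forall k, segment_closed (C k))
  (Cdisj : forall i j, i + 2 <= j -> C i `&` C j = set0)
  (Cv : forall k, (C (k - 1) `&` C k) (v k))
  (Ccorner : forall k a b, 0 <= a <= smooth_step (2 * r k) ->
    0 <= b <= smooth_step (2 * r k) ->
    (C (k - 1) `&` C k) (v k + a *: (v (k - 1) - v k) + b *: (v (k + 1) - v k))).

Let ramp01 k t : 0 <= ramp k t <= 1.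
Proof. by rewrite /ramp smooth_step_ge0 smooth_step_le1. Qed.

Let Cnone i j z : i + 2 <= j -> C i z -> C j z -> False.
Proof. by move=> ij Ci Cj; have : (C i `&` C j) z by []; rewrite Cdisj. Qed.

Lemma rounded_at_corner k t : k%:~R - r k <= t <= k%:~R + r k ->
  (C (k - 1) `&` C k) (rounded t).
Proof.
move=> /andP[t1 t2].
have h1 := r4 k; have h2 := r4 (k - 1); have h3 := r4 (k + 1).
rewrite (@rounded_corner k); [|lra|lra].
apply: Ccorner; apply/andP; split.
- by rewrite subr_ge0; have /andP[] := ramp01 (k - 1) t.
- exact: ramp_large.
- by have /andP[] := ramp01 k t.
- exact: ramp_small.
Qed.

Lemma rounded_mem k t : k%:~R <= t <= k%:~R + 1 -> C k (rounded t).
Proof.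
move=> /andP[t1 t2]; have h0 := r0 k; have [tk|kt] := leP t (k%:~R + r k).
  by have [] := @rounded_at_corner k t; first by apply/andP; split; lra.
have h1 := r0 (k + 1); have [tk1|kt1] := leP (k%:~R + 1 - r (k + 1)) t.
  have [] := @rounded_at_corner (k + 1) t; last by rewrite addrK.
  by rewrite intp; apply/andP; split; lra.
have h2 := r4 (k - 1).
rewrite (@rounded_corner k); [|lra|lra].
rewrite /corner (@ramp1 (k - 1)); last by rewrite intm !subrK; lra.
rewrite subrr scale0r addr0; apply: Cseg; [|have [+ _] := Cv (k + 1)|exact: ramp01].
  by have [] := Cv k.
by rewrite addrK.
Qed.

(** If the edges at [v k] pointed the same way, the shorter would lie along the longer. By convexity
    its far end would belong to the set that contains the longer edge, but that end also belongs to
    a set two steps away in the chain. *)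
Lemma corner_directions k a b : 0 <= a -> 0 <= b ->
  a *: (v (k - 1) - v k) = b *: (v (k + 1) - v k) -> a = 0 /\ b = 0.
Proof.
have half a' b' (x y : V) : 0 <= a' -> a' <= b' -> 0 < b' ->
    a' *: x = b' *: y -> exists2 c, 0 <= c <= 1 & y = c *: x.
  move=> a0 ab b0 E; exists (a' / b'); last first.
    by rewrite mulrC -scalerA E scalerA mulVf ?gt_eqF// scale1r.
  by rewrite divr_ge0 ?(ltW b0)//= ler_pdivrMr// mul1r.
have [vk1 vk] := Cv k; have [wk wk1] := Cv (k + 1); have [uk uk1] := Cv (k - 1).
rewrite addrK in wk.
move=> a0 b0 E; have [ab|ba] := leP a b.
  move: b0; rewrite le_eqVlt => /orP[/eqP b0|b0].
    by split => //; apply/eqP; rewrite eq_le a0 b0 ab.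
  have [c c01 wc] := half _ _ _ _ a0 ab b0 E; exfalso.
  apply: (@Cnone (k - 1) (k + 1) (v (k + 1))); [lia| |exact: wk1].
  have -> : v (k + 1) = v k + c *: (v (k - 1) - v k) by rewrite -wc subrKC.
  exact: Cseg.
have a1 : 0 < a by exact: le_lt_trans b0 ba.
have [c c01 uc] := half _ _ _ _ b0 (ltW ba) a1 (esym E); exfalso.
apply: (@Cnone (k - 1 - 1) k (v (k - 1))); [lia|exact: uk|].
have -> : v (k - 1) = v k + c *: (v (k + 1) - v k) by rewrite -uc subrKC.
exact: Cseg.
Qed.

(** Both ramps are monotone, so equal points would give equal nonnegative multiples of the two edge
    vectors, and by [corner_directions] neither ramp would move between [s] and [t]. But
    [ramp (k - 1)] climbs strictly if [s] is before [k + r k], and [ramp k] does otherwise. *)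
Lemma corner_neq k s t : s < t -> k%:~R - 1 + r (k - 1) <= s ->
  t <= k%:~R + 1 - r (k + 1) -> corner k s <> corner k t.
Proof.
move=> st h1 h2 E.
have E' : (ramp (k - 1) t - ramp (k - 1) s) *: (v (k - 1) - v k) =
    (ramp k t - ramp k s) *: (v (k + 1) - v k).
  move: E; rewrite /corner -!addrA => /addrI E.
  rewrite (_ : ramp (k - 1) t - ramp (k - 1) s =
    (1 - ramp (k - 1) s) - (1 - ramp (k - 1) t)); last by ring.
  rewrite scalerBl [RHS]scalerBl; apply/eqP.
  by rewrite subr_eq addrAC -subr_eq opprK E addrC.
have [||ua wa] := corner_directions _ _ E'; rewrite ?subr_ge0 ?ramp_le// ?ltW//.
have k0 := r0 k; have km := r0 (k - 1); have kp := r0 (k + 1).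
have [sk|ks] := ltP s (k%:~R + r k).
  have : ramp (k - 1) s < ramp (k - 1) t.
    by apply: ramp_lt; rewrite // ?intm ?subrK ?subrK; lra.
  by move/eqP: ua; rewrite subr_eq0 => /eqP ->; rewrite ltxx.
have : ramp k s < ramp k t by apply: ramp_lt => //; lra.
by move/eqP: wa; rewrite subr_eq0 => /eqP ->; rewrite ltxx.
Qed.

(** Disjointness puts the times in equal or consecutive unit intervals. Either one corner formula
    covers both and [corner_neq] applies, or one time is in an outer corner window, where its point
    belongs to a further set, disjoint from one that contains the other point. *)
Lemma rounded_inj s t : rounded s = rounded t -> s = t.
Proof.
wlog st : s t / s < t.
  by move=> H E; have [/H|/H/(_ (esym E))|//] := ltgtP s t; [exact|].
move=> E; exfalso.
have [i1 i2] := andP (floor_itv s); have [j1 j2] := andP (floor_itv t).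
set i := Num.floor s in i1 i2; set j := Num.floor t in j1 j2.
rewrite intp in i2; rewrite intp in j2.
have Cs : C i (rounded s) by apply: rounded_mem; rewrite i1 ltW.
have Ct : C j (rounded t) by apply: rounded_mem; rewrite j1 ltW.
have ij : i <= j by exact/le_floor/ltW.
have ji : j <= i + 1.
  rewrite leNgt; apply/negP => h; apply: (@Cnone i j (rounded s)) => //; first by lia.
  by rewrite E.
have apart k : k%:~R - 1 + r (k - 1) <= s -> t <= k%:~R + 1 - r (k + 1) -> False.
  move=> h1 h2; apply: (@corner_neq k s t) => //.
  have kp := r0 (k + 1); have km := r0 (k - 1).
  by rewrite -!rounded_corner//; lra.
have [jE|jE] : j = i \/ j = i + 1 by lia.
  rewrite jE in j2.
  have h0 := r0 i; have h1 := r0 (i + 1).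
  have [si|si] := leP (i%:~R + r i) s.
    apply: (apart (i + 1)); first by rewrite intp !addrK; lra.
    by rewrite intp; have := r4 (i + 1 + 1); lra.
  have [ti|ti] := leP t (i%:~R + 1 - r (i + 1)).
    by apply: (apart i) => //; have := r4 (i - 1); lra.
  have [s1 s2] := @rounded_at_corner i s ltac:(apply/andP; split; lra).
  have [t1 t2] : (C (i + 1 - 1) `&` C (i + 1)) (rounded t).
    by apply: rounded_at_corner; rewrite intp; apply/andP; split; lra.
  by apply: (@Cnone (i - 1) (i + 1) (rounded s)) => //; [lia|rewrite E].
rewrite jE in j1 j2; rewrite intp in j1 j2.
have h0 := r0 i; have h1 := r0 (i + 1 + 1).
have [si|si] := leP (i%:~R + r i) s; last first.
  have [s1 _] := @rounded_at_corner i s ltac:(apply/andP; split; lra).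
  apply: (@Cnone (i - 1) (i + 1) (rounded s)) => //; first by lia.
  by rewrite E -jE.
have [ti|ti] := leP t (i%:~R + 2 - r (i + 1 + 1)).
  by apply: (apart (i + 1)); rewrite ?intp ?addrK ?addrK; lra.
have [_ t1] : (C (i + 1 + 1 - 1) `&` C (i + 1 + 1)) (rounded t).
  by apply: rounded_at_corner; rewrite !intp; apply/andP; split; lra.
by apply: (@Cnone i (i + 1 + 1) (rounded s)) => //; [lia|rewrite E].
Qed.

Lemma elementary_ramp (U : set R) (k : int) (f : R -> R) :
  elementary U f -> elementary U (fun s => ramp k (f s)).
Proof.
move=> ef; apply: elementary_smooth_step; apply: elementary_mul; last exact: elementary_cst.
apply: elementary_add; last exact: elementary_cst.
by apply: elementary_add; [|exact: elementary_cst].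
Qed.

Lemma ramp_derive (k : int) : exists2 d : R -> R, forall t : R, is_derive t 1 (ramp k) (d t) &
  (forall t : R, 0 <= d t) /\
  (forall t : R, k%:~R - r k < t < k%:~R + 1 + r (k + 1) -> 0 < d t).
Proof.
have [ds Hs [d0 d1]] := @smooth_step_derive R.
set L := 1 + r k + r (k + 1); have L0 : 0 < L := len0 k.
exists (fun t => ds ((t - k%:~R + r k) / L) * L^-1).
  move=> t; apply: (@is_derive1_comp _ smooth_step (fun t => (t - k%:~R + r k) / L)) => //.
  have h1 : is_derive t 1 (fun t : R => t - k%:~R) (1 - 0).
    exact: is_deriveB (is_derive_id _ _) (is_derive_cst _ _ _).
  have h2 : is_derive t 1 (fun t : R => t - k%:~R + r k) (1 - 0 + 0).
    exact: is_deriveD h1 (is_derive_cst _ _ _).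
  have h3 := @is_deriveM _ _ _ (cst L^-1) t 1 _ _ h2 (is_derive_cst _ _ _).
  by apply: (is_derive_eq h3); rewrite /GRing.scale /=; ring.
split => t; first by rewrite mulr_ge0 ?invr_ge0 ?(ltW L0).
move=> /andP[t1 t2]; rewrite mulr_gt0 ?invr_gt0// d1// ltr_pdivrMr// mul1r.
by rewrite divr_gt0//=; rewrite ?/L; lra.
Qed.

Section Reparametrization.
Variables (U : set R) (w dw : R -> R).
Hypotheses (oU : open U) (ew : elementary U w)
  (Dw : forall t, U t -> is_derive t 1 w (dw t)) (dw0 : forall t, U t -> 0 < dw t).

Let near_corner t : U t -> exists k, k%:~R - 1 / 2 <= w t < k%:~R + 1 / 2 /\
  \forall s \near t, rounded (w s) = corner k (w s).
Proof.
move=> Ut; have [k [kt Hk]] := rounded_near (w t); exists k; split => //.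
have cw : {for t, continuous w}.
  have [d _] := Dw Ut.
  exact/differentiable_continuous/derivable1_diffP.
move/cvgrPdist_lt: cw => /(_ (1 / 4) ltac:(lra)).
by apply: filterS => s; rewrite distrC => /Hk.
Qed.

(** The composite itself is locally elementary, since substituting [w] into the ramps stays in the
    class; this spares a chain rule of higher order. *)
Lemma rounded_smooth k t : U t -> derivable (derive1n k (rounded \o w)) t 1.
Proof.
apply: locally_elementary_smooth => // {}t Ut.
have [j [_ Hj]] := near_corner Ut.
exists (fun s => 1 + -1 * ramp (j - 1) (w s)), (fun s => ramp j (w s)).
exists (v j), (v (j - 1) - v j), (v (j + 1) - v j); split.
- apply: elementary_add; first exact: elementary_cst.
  by apply: elementary_mul; [exact: elementary_cst|exact: elementary_ramp].
- exact: elementary_ramp.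
- by apply: filterS Hj => s /= ->; rewrite mulN1r.
Qed.

(** The argument of [corner_neq] with speeds for increments: a zero derivative forces both
    coefficients to vanish, yet [ramp j] has positive speed if [w t] is at least [j], and
    [ramp (j - 1)] has if it is less. *)
Lemma rounded_regular t : U t -> derive1 (rounded \o w) t != 0.
Proof.
move=> Ut; have [j [/andP[j1 j2] Hj]] := near_corner Ut.
have [da Ha [a0 a1]] := ramp_derive (j - 1).
have [db Hb [b0 b1]] := ramp_derive j.
have Da : is_derive t 1 (fun s => 1 - ramp (j - 1) (w s)) (- (da (w t) * dw t)).
  have h := @is_derive1_comp _ (ramp (j - 1)) w t _ _ (Ha _) (Dw Ut).
  by have := @is_deriveB _ _ _ _ _ t 1 _ _ (is_derive_cst (1 : R) _ _) h; rewrite sub0r.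
have Db : is_derive t 1 (fun s => ramp j (w s)) (db (w t) * dw t).
  exact: @is_derive1_comp _ (ramp j) w t _ _ (Hb _) (Dw Ut).
have D := is_derive_combination (v j) (v (j - 1) - v j) (v (j + 1) - v j) Da Db.
rewrite derive1E.
have -> : 'D_1 (rounded \o w) t = 'D_1 (fun s => v j +
    (1 - ramp (j - 1) (w s)) *: (v (j - 1) - v j) + ramp j (w s) *: (v (j + 1) - v j)) t.
  by apply: near_eq_derive.
rewrite (@derive_val _ _ _ _ _ _ _ D); apply/eqP; rewrite scaleNr addrC => /eqP; rewrite subr_eq0 => /eqP.
move=> /esym/corner_directions[||/eqP ua /eqP wa]; rewrite ?mulr_ge0 ?(ltW (dw0 Ut))//.
move: ua wa; rewrite !mulf_eq0 ?(gt_eqF (dw0 Ut)) !orbF.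
have k0 := r0 j; have km := r0 (j - 1); have kp := r0 (j + 1).
have [sk _ /eqP wa|ks /eqP ua _] := leP (j%:~R) (w t).
  have : 0 < db (w t) by apply: b1; apply/andP; split; lra.
  by rewrite wa ltxx.
have : 0 < da (w t) by apply: a1; rewrite intm !subrK; apply/andP; split; lra.
by rewrite ua ltxx.
Qed.

End Reparametrization.
End RoundedPolygon.

Lemma rounded_chain (R : realType) (V : normedModType R) (C : int -> set V) :
  (forall k, open (C k)) -> (forall k, segment_closed (C k)) ->
  (forall k, C k `&` C (k + 1) !=set0) ->
  (forall i j, i + 2 <= j -> C i `&` C j = set0) ->
  exists G : R -> V, [/\ forall k t, k%:~R <= t <= k%:~R + 1 -> C k (G t),
    injective G & forall (U : set R) (w dw : R -> R), open U -> elementary U w ->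
      (forall t, U t -> is_derive t 1 w (dw t)) -> (forall t, U t -> 0 < dw t) ->
      forall t, U t -> (forall k, derivable (derive1n k (G \o w)) t 1) /\
        derive1 (G \o w) t != 0].
Proof.
move=> oC sC CC CD.
have /choice[v Hv] k : exists x, (C (k - 1) `&` C k) x.
  by have [x] := CC (k - 1); rewrite subrK; exists x.
have /choice[r Hr] k : exists r : R, 0 < r <= 1 / 4 /\ forall a b,
    0 <= a <= smooth_step (2 * r) -> 0 <= b <= smooth_step (2 * r) ->
    (C (k - 1) `&` C k) (v k + a *: (v (k - 1) - v k) + b *: (v (k + 1) - v k)).
  set u := v (k - 1) - v k; set w := v (k + 1) - v k.
  have /nbhs_ballP[d /= d0 dC] : nbhs (v k) (C (k - 1) `&` C k).
    by apply: open_nbhs_nbhs; split => //; exact: openI.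
  (* With coefficients at most [d] over this sum, the vertex is displaced by less than [d]. *)
  have uw : 0 < `|u| + `|w| + 1 by rewrite ltr_wpDl.
  have [r r0 re] := smooth_step_small (divr_gt0 d0 uw).
  exists r; split => // a b /andP[a0 ar] /andP[b0 br]; apply: dC.
  rewrite -ball_normE /= -addrA opprD addrA subrr add0r normrN.
  apply: le_lt_trans (ler_normD _ _) _; rewrite !normrZ !ger0_norm//.
  have h1 : a * `|u| <= d / (`|u| + `|w| + 1) * `|u|.
    by rewrite ler_wpM2r// (le_trans ar).
  have h2 : b * `|w| <= d / (`|u| + `|w| + 1) * `|w|.
    by rewrite ler_wpM2r// (le_trans br).
  apply: le_lt_trans (lerD h1 h2) _; rewrite -mulrDr mulrAC ltr_pdivrMr//.
  by rewrite ltr_pM2l// ltrDl.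
have r0 k : 0 < r k by have [/andP[]] := Hr k.
have r4 k : r k <= 1 / 4 by have [/andP[]] := Hr k.
have cor k := (Hr k).2.
exists (rounded v r); split.
- by move=> k t; exact: (@rounded_mem _ _ C).
- by move=> s t; exact: (@rounded_inj _ _ C).
- move=> U w dw oU ew Dw dw0 t Ut; split.
    by move=> k; exact: (rounded_smooth r0 r4 oU ew Dw).
  exact: (@rounded_regular _ _ C v r r0 r4 sC CD Hv U w dw).
Qed.

(** * Closing up the arc *)

(** The preimage of a closed set [A] under the inverse is the image under [F] of the compact part of
    [K] in [A], hence closed in a Hausdorff space. *)
Lemma compact_inverse_continuous (X : ptopologicalType) (Y : topologicalType)
    (K : set X) (F : X -> Y) : hausdorff_space Y -> compact K ->
  {within K, continuous F} -> {in K &, injective F} ->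
  exists2 G : Y -> X, {within F @` K, continuous G} & forall x, K x -> G (F x) = x.
Proof.
move=> hY cK cF FI.
have /choice[G HG] y : exists x, (F @` K) y -> K x /\ F x = y.
  have [[x Kx Fx]|Ny] := pselect ((F @` K) y); first by exists x.
  by exists point.
have GF x : K x -> G (F x) = x.
  move=> Kx; have [|KG FG] := HG (F x); first by exists x.
  by apply: FI; rewrite ?inE.
exists G => //; apply/continuous_closedP => A cA.
apply/closed_subspaceP; exists (F @` (A `&` K)).
  apply: compact_closed => //; apply: continuous_compact.
    by apply: continuous_subspaceW cF => x [].
  by rewrite setIC; exact: compact_closedI.
apply/seteqP; split => y [].
  by move=> [x [Ax Kx] <-] _; split; [change (A (G (F x))); rewrite GF|exists x].
move=> /= AG [x Kx Fx]; split; last by exists x.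
by exists x => //; split => //; rewrite -(GF x Kx) Fx.
Qed.

Lemma unit_circle_compact (R : realType) : compact (@unit_circle R).
Proof.
have cc (i : 'I_2) : continuous (fun z : 'rV[R]_2 => z ord0 i ^+ 2).
  move=> z; apply: (@continuous_comp _ _ _ (fun z : 'rV[R]_2 => z ord0 i) (fun x => x ^+ 2)).
    exact: coord_continuous.
  exact: exprn_continuous.
apply: (@subclosed_compact _ _ [set z : 'rV[R]_2 | forall i, `[-1, 1]%classic (z ord0 i)]).
- pose F (z : 'rV[R]_2) := z ord0 ord0 ^+ 2 + z ord0 (@Ordinal 2 1 isT) ^+ 2.
  have cF : continuous F by move=> z; exact: (cvgD (cc ord0 z) (cc (@Ordinal 2 1 isT) z)).
  have := (continuous_closedP F).1 cF [set y | y = 1] (@closed_eq _ 1).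
  exact.
- exact: (@rV_compact R 2 (fun=> `[-1, 1]%classic) (fun=> @segment_compact _ _ _)).
- move=> z /= z1 i; rewrite in_itv /=.
  suff zi : z ord0 i ^+ 2 <= 1 by rewrite -ler_norml -(@expr_le1 _ 2)// real_normK ?num_real.
  rewrite -z1; case: i => -[|[|//]] /= h.
    rewrite (_ : Ordinal h = ord0); last exact: val_inj.
    by rewrite lerDl sqr_ge0.
  rewrite (_ : Ordinal h = @Ordinal 2 1 isT); last exact: val_inj.
  by rewrite lerDr sqr_ge0.
Qed.

Lemma derive1n_eq_open (R : realType) (V : normedModType R) (U : set R)
    (f g : R -> V) : open U -> {in U, f =1 g} ->
  forall k, {in U, derive1n k f =1 derive1n k g}.
Proof.
move=> oU fg; elim=> [//|k IH] x; rewrite inE => Ux; apply: derive1_near.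
by near=> y; apply: IH; rewrite inE; near: y; exact: open_nbhs_nbhs.
Unshelve. all: by end_near. Qed.

(** * From a curve on the line to an arc with its endpoints *)

Section ArcParametrization.
Context {R : realType}.
Implicit Types t : R.

(** An increasing bijection from []0, 1[] to the line, chosen rational so as to be [elementary]. *)
Definition stretch t : R := (1 - t)^-1 - t^-1.

Lemma elementary_stretch : elementary `]0, 1[%classic stretch.
Proof.
have e1 : elementary `]0, 1[%classic (fun t => (1 + -1 * t)^-1).
  apply: elementary_inv => [|t]; last by rewrite /= in_itv /= mulN1r subr_eq0 => /andP[_ /gt_eqF ->].
  apply: elementary_add; first exact: elementary_cst.
  by apply: elementary_mul; [exact: elementary_cst|exact: elementary_id].
have e2 : elementary `]0, 1[%classic (fun t => (id t)^-1).
  apply: elementary_inv => [|t]; first exact: elementary_id.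
  by rewrite /= in_itv /= => /andP[/gt_eqF ->].
have -> : stretch = (fun t => (1 + -1 * t)^-1 + -1 * (id t)^-1).
  by apply/funext => t; rewrite /stretch !mulN1r.
by apply: elementary_add => //; apply: elementary_mul => //; exact: elementary_cst.
Qed.

Lemma stretch_derive t : 0 < t < 1 ->
  is_derive t 1 stretch ((1 - t) ^- 2 + t ^- 2).
Proof.
move=> /andP[t0 t1].
have d1 : is_derive t 1 (fun s : R => 1 - s) (0 - 1).
  exact: is_deriveB (is_derive_cst _ _ _) (is_derive_id _ _).
have n1 : 1 - t != 0 by rewrite subr_eq0 gt_eqF.
have d2 := @is_deriveV R _ t _ 1 n1 d1.
have d3 := @is_deriveV R id t _ 1 (lt0r_neq0 t0) (is_derive_id _ _).
have d4 := is_deriveB d2 d3.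
by apply: (is_derive_eq d4); rewrite /GRing.scale /=; ring.
Qed.

Lemma stretch_inj t t' : 0 < t < 1 -> 0 < t' < 1 -> stretch t = stretch t' -> t = t'.
Proof.
wlog tt : t t' / t < t'.
  by move=> H t01 t01' E; have [/H|/H/(_ t01' t01 (esym E))|//] := ltgtP t t'; [exact|].
move=> /andP[t0 t1] /andP[t0' t1'] E; exfalso.
have h1 : (1 - t)^-1 < (1 - t')^-1 by rewrite ltf_pV2 ?posrE; lra.
have h2 : t'^-1 < t^-1 by rewrite ltf_pV2 ?posrE.
by rewrite /stretch in E; lra.
Qed.

Lemma stretchC t : stretch (1 - t) = - stretch t.
Proof. by rewrite /stretch subKr opprB. Qed.

(** The excess 2 in [m.+2] absorbs [(1 - t)^-1], which is at most 2 when [t < 1 / 2]. *)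
Lemma stretch_le (m : nat) t : 0 < t -> t < m.+2%:R^-1 -> stretch t <= - m%:R.
Proof.
move=> t0 tm.
have m2 : t^-1 > m.+2%:R by rewrite -[ltLHS]invrK ltf_pV2 ?posrE ?invr_gt0.
have t2 : t < 1 / 2.
  apply: lt_le_trans tm _; rewrite div1r lef_pV2 ?posrE//.
  by rewrite ler_nat.
have : (1 - t)^-1 <= 2 by rewrite -[leRHS]invrK lef_pV2 ?posrE; lra.
by move: m2; rewrite /stretch -addn2 natrD; lra.
Qed.

Lemma smooth_arc_in_chain (V : normedModType R) (C : int -> set V) (G0 : set V)
    (p q : V) :
  (forall k, [/\ open (C k), segment_closed (C k) & C k `<=` G0]) ->
  (forall k, C k `&` C (k + 1) !=set0) ->
  (forall i j, i + 2 <= j -> C i `&` C j = set0) ->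
  (forall r : R, 0 < r -> exists m : nat, forall k : int, m%:Z <= k -> C k `<=` ball q r) ->
  (forall r : R, 0 < r -> exists m : nat, forall k : int, k <= - m%:Z -> C k `<=` ball p r) ->
  exists h : R -> V, [/\ h 0 = p /\ h 1 = q,
    forall t, 0 <= t <= 1 -> {for t, continuous h},
    forall t, 0 < t < 1 -> G0 (h t),
    forall s t, 0 < s < 1 -> 0 < t < 1 -> h s = h t -> s = t &
    forall t, 0 < t < 1 -> (forall k, derivable (derive1n k h) t 1) /\ derive1 h t != 0].
Proof.
move=> HC CC CD Cq Cp.
have oC k : open (C k) by have [] := HC k.
have sC k : segment_closed (C k) by have [] := HC k.
have CG k : C k `<=` G0 by have [] := HC k.
have [G [GC GI Gsm]] := rounded_chain oC sC CC CD.
have inI t : `]0, 1[%classic t <-> 0 < t < 1 by rewrite /= in_itv.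
have oI : open (`]0, 1[%classic : set R) by exact: interval_open.
have Gfloor s : C (Num.floor s) (G s).
  apply: GC; have /andP[s1 s2] := floor_itv s; rewrite s1 /= ltW//.
  by move: s2; rewrite intrD.
have smooth t : 0 < t < 1 -> (forall k, derivable (derive1n k (G \o stretch)) t 1) /\
    derive1 (G \o stretch) t != 0.
  move=> /inI t01.
  apply: (Gsm `]0, 1[%classic stretch (fun t => (1 - t) ^- 2 + t ^- 2)) => //.
  - exact: elementary_stretch.
  - by move=> s /inI; exact: stretch_derive.
  - move=> s /inI/andP[s0 s1].
    by rewrite addr_gt0// invr_gt0 exprn_gt0// subr_gt0.
(* The constant values beyond 0 and 1 make [h] continuous at the ends from both sides. *)
pose h t := if t <= 0 then p else if 1 <= t then q else G (stretch t).
have hE t : 0 < t < 1 -> h t = G (stretch t).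
  by move=> /andP[t0 t1]; rewrite /h !leNgt t0 t1.
have h0 : h 0 = p by rewrite /h lexx.
have h1 : h 1 = q by rewrite /h lexx ler10.
have hD k t : 0 < t < 1 -> derive1n k h t = derive1n k (G \o stretch) t.
  move=> /inI t01; apply: (derive1n_eq_open oI); last by rewrite inE.
  by move=> s; rewrite inE => /inI; exact: hE.
have sm t : 0 < t < 1 -> (forall k, derivable (derive1n k h) t 1) /\ derive1 h t != 0.
  move=> t01; have [d1 d2] := smooth t t01; split=> [k|]; last first.
    by change (derive1n 1 h t != 0); rewrite hD.
  suff : is_derive t 1 (derive1n k h) ('D_1 (derive1n k (G \o stretch)) t) by case.
  apply: (near_eq_is_derive _ (derivableP (d1 k))).
  apply: filterS (open_nbhs_nbhs (conj oI ((inI t).2 t01))) => s /inI s01.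
  by rewrite hD.
exists h; split => //; last first.
- move=> s t s01 t01; rewrite !hE// => /GI; exact: stretch_inj.
- by move=> t t01; rewrite hE//; apply: CG; exact: Gfloor.
move=> t /andP[]; rewrite le_eqVlt => /orP[/eqP <- _|t0].
  apply/cvgrPdist_lt => e e0; have [m Hm] := Cp e e0.
  have m0 : 0 < m.+2%:R^-1 :> R by rewrite invr_gt0.
  near=> s; rewrite h0; have [s0|s0] := leP s 0; first by rewrite /h s0 subrr normr0.
  have sm2 : s < m.+2%:R^-1 by near: s; exact: lt_nbhsl.
  have s1 : s < 1.
    by apply: lt_le_trans sm2 _; rewrite invf_le1// ler1n.
  (* So [h s] lies in a set of the chain that is contained in the prescribed ball about [p]. *)
  have fm : Num.floor (stretch s) <= - m%:Z.
    rewrite -(ler_int R) rmorphN /= -pmulrn.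
    by apply: le_trans (floor_le _) _; exact: stretch_le.
  by rewrite hE ?s0//; have := Hm _ fm _ (Gfloor (stretch s)); rewrite -ball_normE.
rewrite le_eqVlt => /orP[/eqP ->|t1].
  apply/cvgrPdist_lt => e e0; have [m Hm] := Cq e e0.
  have m0 : 0 < m.+2%:R^-1 :> R by rewrite invr_gt0.
  near=> s; rewrite h1; have [s1|s1] := leP 1 s.
    by rewrite /h s1 leNgt (lt_le_trans ltr01 s1) /= subrr normr0.
  have sm2 : 1 - m.+2%:R^-1 < s by near: s; apply: lt_nbhsr; rewrite ltrBlDr ltrDl.
  have s0 : 0 < s.
    apply: le_lt_trans sm2; rewrite subr_ge0 invf_le1//.
    by rewrite ler1n.
  have fm : m%:Z <= Num.floor (stretch s).
    rewrite floor_ge_int -pmulrn -[s in stretch s](subKr 1) stretchC lerNr.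
    by apply: stretch_le; [rewrite subr_gt0|rewrite ltrBlDr -ltrBlDl].
  by rewrite hE ?s0//; have := Hm _ fm _ (Gfloor (stretch s)); rewrite -ball_normE.
have [/(_ 0%N) d _] := sm t ltac:(apply/andP; split => //).
exact/differentiable_continuous/derivable1_diffP.
Unshelve. all: by end_near. Qed.

End ArcParametrization.

(** * The arc and the smooth open arc as two half circles *)

Section GlueCircle.
Context {R : realType} {V : normedModType R}.
Variables (f h : R -> V).
Hypotheses (cf : continuous f) (ch : forall t, 0 <= t <= 1 -> {for t, continuous h})
  (fh0 : f 0 = h 0) (fh1 : f 1 = h 1)
  (fI : forall s t, 0 <= s <= 1 -> 0 <= t <= 1 -> f s = f t -> s = t)
  (hI : forall s t, 0 < s < 1 -> 0 < t < 1 -> h s = h t -> s = t)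
  (fh : forall s t, 0 <= s <= 1 -> 0 < t < 1 -> f s <> h t).

Let one : 'I_2 := @Ordinal 2 1 isT.
Let abscissa (z : 'rV[R]_2) : R := (1 + z ord0 ord0) / 2.

(** The horizontal projection stands in for an angle on each half circle. The points of ordinate 0
    go to [f], but [h] takes the same values there, so each formula is valid on a closed half. *)
Let glue (z : 'rV[R]_2) : V :=
  if 0 <= z ord0 one then f (abscissa z) else h (abscissa z).

Let abscissa_continuous : continuous abscissa.
Proof.
move=> z; have cz := @coord_continuous R 1 2 ord0 ord0 z.
exact: (cvgM (cvgD (cvg_cst _) cz) (cvg_cst _)).
Qed.

Let abscissa01 z : unit_circle z -> 0 <= abscissa z <= 1.
Proof.
move=> z1; have : z ord0 ord0 ^+ 2 <= 1 by rewrite -z1 lerDl sqr_ge0.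
rewrite -real_normK ?num_real// expr_le1// ler_norml => /andP[h1 h2].
by rewrite /abscissa; apply/andP; split; lra.
Qed.

Let abscissa_oo z : unit_circle z -> z ord0 one != 0 -> 0 < abscissa z < 1.
Proof.
move=> z1 zn0; have : z ord0 ord0 ^+ 2 < 1.
  by rewrite -z1 ltrDl lt_neqAle sqr_ge0 eq_sym sqrf_eq0 zn0.
rewrite -real_normK ?num_real// expr_lt1// ltr_norml => /andP[h1 h2].
by rewrite /abscissa; apply/andP; split; lra.
Qed.

Let abscissa_end z : unit_circle z -> z ord0 one = 0 -> f (abscissa z) = h (abscissa z).
Proof.
move=> z1 z0; have : (z ord0 ord0 - 1) * (z ord0 ord0 + 1) = 0.
  have E : z ord0 ord0 ^+ 2 + z ord0 one ^+ 2 = 1 := z1.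
  by move: E; rewrite z0 expr0n /= addr0 => E; rewrite -subr_sqr E expr1n subrr.
move=> /eqP; rewrite mulf_eq0 => /orP[|] /eqP zE.
  by rewrite (_ : abscissa z = 1)// /abscissa; lra.
by rewrite (_ : abscissa z = 0)// /abscissa; lra.
Qed.

(** A nonnegative product of ordinates means that the points share a closed half circle, which
    settles the sign that the equation of the circle leaves open. *)
Let circle_eq (z z' : 'rV[R]_2) : unit_circle z -> unit_circle z' ->
  abscissa z = abscissa z' -> 0 <= z ord0 one * z' ord0 one -> z = z'.
Proof.
move=> z1 z1' zz; have x : z ord0 ord0 = z' ord0 ord0.
  by move: zz; rewrite /abscissa; lra.
have E : z ord0 ord0 ^+ 2 + z ord0 one ^+ 2 = 1 := z1.
have E' : z' ord0 ord0 ^+ 2 + z' ord0 one ^+ 2 = 1 := z1'.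
move=> yy; have y : z ord0 one = z' ord0 one.
  have : (z ord0 one - z' ord0 one) * (z ord0 one + z' ord0 one) = 0.
    by rewrite -subr_sqr; rewrite x in E; lra.
  move=> /eqP; rewrite mulf_eq0 => /orP[/eqP|/eqP y]; first by lra.
  have y' : z ord0 one = - z' ord0 one by lra.
  have : z' ord0 one ^+ 2 <= 0 by rewrite y' in yy; lra.
  move=> y2; have : z' ord0 one ^+ 2 == 0 by rewrite eq_le y2 sqr_ge0.
  by rewrite sqrf_eq0 => /eqP; lra.
apply/rowP => -[[|[|//]] i].
  by rewrite (_ : Ordinal i = ord0)//; exact: val_inj.
by rewrite (_ : Ordinal i = one)//; exact: val_inj.
Qed.

Let glue_inj : {in @unit_circle R &, injective glue}.
Proof.
move=> z z'; rewrite !inE => z1 z1'; rewrite /glue.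
have [y|y] := leP 0 (z ord0 one); have [y'|y'] := leP 0 (z' ord0 one) => E.
- apply: circle_eq => //; last exact: mulr_ge0.
  by apply: fI => //; exact: abscissa01.
- by exfalso; apply: fh E; [exact: abscissa01|apply: abscissa_oo; rewrite ?lt_eqF].
- by exfalso; apply: fh (esym E); [exact: abscissa01|apply: abscissa_oo; rewrite ?lt_eqF].
- apply: circle_eq => //; last by rewrite nmulr_lge0// ltW.
  by apply: hI => //; apply: abscissa_oo; rewrite ?lt_eqF.
Qed.

Let glue_continuous : {within @unit_circle R, continuous glue}.
Proof.
have cy : continuous (fun z : 'rV[R]_2 => z ord0 one) by exact: coord_continuous.
have cS : closed (@unit_circle R).
  by apply: compact_closed; [exact: norm_hausdorff|exact: unit_circle_compact].
pose A : set 'rV[R]_2 := @unit_circle R `&` [set z | 0 <= z ord0 one].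
pose B : set 'rV[R]_2 := @unit_circle R `&` [set z | z ord0 one <= 0].
have -> : @unit_circle R = A `|` B.
  apply/seteqP; split => [z z1|z [[]|[]]//].
  by have [y|y] := leP 0 (z ord0 one); [left|right; split => //; exact: ltW].
apply: withinU_continuous.
- apply: closedI => //.
  by have := (continuous_closedP _).1 cy _ (@closed_ge _ 0).
- apply: closedI => //.
  by have := (continuous_closedP _).1 cy _ (@closed_le _ 0).
- apply: (@subspace_eq_continuous _ _ _ (f \o abscissa)).
    move=> z; rewrite inE => -[_ /= y]; change (f (abscissa z) = glue z).
    rewrite /glue; case: leP => // y'.
    by have := lt_le_trans y' y; rewrite ltxx.
  by apply: continuous_subspaceT => z; apply: continuous_comp; [exact: abscissa_continuous|exact: cf].
- apply: (@subspace_eq_continuous _ _ _ (h \o abscissa)).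
    move=> z; rewrite inE => -[z1 /= y]; change (h (abscissa z) = glue z).
    rewrite /glue; case: leP => // y'.
    by rewrite -abscissa_end//; apply/eqP; rewrite eq_le y y'.
  apply: continuous_in_subspaceT => z; rewrite inE => -[z1 _].
  by apply: continuous_comp; [exact: abscissa_continuous|apply: ch; exact: abscissa01].
Qed.

Let on_circle (t s : R) : 'rV[R]_2 :=
  \row_i (if i == ord0 then 2 * t - 1 else s * Num.sqrt (1 - (2 * t - 1) ^+ 2)).

Let on_circleP t s : 0 <= t <= 1 -> s ^+ 2 = 1 -> unit_circle (on_circle t s).
Proof.
move=> /andP[t0 t1] s1; rewrite /unit_circle /= !mxE /= exprMn s1 mul1r sqr_sqrtr.
  by rewrite addrC subrK.
have -> : 1 - (2 * t - 1) ^+ 2 = 4 * (t * (1 - t)) by ring.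
by rewrite !mulr_ge0//; lra.
Qed.

Let abscissa_on_circle t s : abscissa (on_circle t s) = t.
Proof. by rewrite /abscissa mxE /=; lra. Qed.

Let glue_upper t : 0 <= t <= 1 -> glue (on_circle t 1) = f t.
Proof. by move=> t01; rewrite /glue mxE /= mul1r sqrtr_ge0 abscissa_on_circle. Qed.

Let glue_lower t : 0 < t < 1 -> glue (on_circle t (-1)) = h t.
Proof.
move=> /andP[t0 t1]; rewrite /glue mxE /= mulN1r oppr_ge0 leNgt sqrtr_gt0.
rewrite abscissa_on_circle (_ : 0 < 1 - (2 * t - 1) ^+ 2)//.
have -> : 1 - (2 * t - 1) ^+ 2 = 4 * (t * (1 - t)) by ring.
by rewrite !mulr_gt0//; lra.
Qed.

Let image_glue : glue @` @unit_circle R = f @` `[0, 1] `|` h @` `]0, 1[.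
Proof.
apply/seteqP; split => [_ [z z1 <-]|v].
  rewrite /glue; case: leP => y; [left|right]; exists (abscissa z) => //=; rewrite in_itv /=.
    exact: abscissa01.
  by apply: abscissa_oo; rewrite ?lt_eqF.
case=> -[t /=]; rewrite in_itv /= => t01 <-.
  by exists (on_circle t 1); [apply: on_circleP; rewrite // expr1n|exact: glue_upper].
exists (on_circle t (-1)); last exact: glue_lower.
by apply: on_circleP; [have /andP[/ltW -> /ltW ->] := t01|rewrite sqrrN expr1n].
Qed.

(** Compactness of the circle makes the inverse of [glue] continuous. The open arc is not compact,
    so its inverse is read off from that one: back to the circle, then [abscissa]. *)
Lemma glue_circle :
  [/\ homeomorphic (@unit_circle R) (f @` `[0, 1] `|` h @` `]0, 1[),
      (f @` `[0, 1] `|` h @` `]0, 1[) `\` f @` `[0, 1] = h @` `]0, 1[ &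
      exists2 g : V -> R, {within h @` `]0, 1[, continuous g} &
        forall t, 0 < t < 1 -> g (h t) = t].
Proof.
have [g cg gK] := compact_inverse_continuous (@norm_hausdorff _ V)
  (@unit_circle_compact R) glue_continuous glue_inj.
rewrite image_glue in cg; split.
- exists glue, g; split => //.
  + split; first by move=> _ [z z1 <-]; rewrite -image_glue; exists z.
    by move=> _ [w + <-]; rewrite -image_glue => -[z z1 <-]; rewrite gK.
  + by split=> // v; rewrite -image_glue => -[z z1 <-]; rewrite gK.
- rewrite setDUl setDv set0U; apply/seteqP; split => [v []//|v hv]; split => //.
  move=> [s /= + sv]; case: hv => t /= + tv; rewrite !in_itv /= => t01 s01.
  by apply: (fh s01 t01); rewrite sv tv.
- exists (abscissa \o g).
    have {}cg : {within h @` `]0, 1[, continuous g}.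
      by apply: continuous_subspaceW cg => w; right.
    by move=> v; exact: (continuous_comp (cg v) (@abscissa_continuous _)).
  move=> t t01 /=; rewrite -glue_lower// gK ?abscissa_on_circle//.
  by apply: on_circleP; [have /andP[/ltW -> /ltW ->] := t01|rewrite sqrrN expr1n].
Qed.

End GlueCircle.

Lemma continuous_comp_within (X Y Z : topologicalType) (K : set Y) (c : X -> Y)
    (f : Y -> Z) : continuous c -> (forall x, K (c x)) ->
  {within K, continuous f} -> continuous (f \o c).
Proof.
move=> cc Kc /subspace_continuousP cf x P Pf.
have nP : nbhs (c x) [set y | K y -> P (f y)] := cf _ (Kc x) P Pf.
have := cc x _ nP.
by apply: (@filterS _ (nbhs x) _) => y; apply; exact: Kc.
Qed.

Section EndpointSequence.
Context {R : realType} {n : nat}.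
Variables (f : R -> 'rV[R]_n) (g : 'rV[R]_n -> R).
Hypotheses (hn : (2 <= n)%N) (cf : continuous f)
  (fI : forall s t, 0 <= s <= 1 -> 0 <= t <= 1 -> f s = f t -> s = t)
  (cg : {within f @` `[0, 1], continuous g})
  (gf : forall t, 0 <= t <= 1 -> g (f t) = t).

Lemma endpoint_sequence (d : nat -> R) : (forall k, 0 < d k) ->
  exists x : nat -> 'rV[R]_n, [/\ forall k, ~ (f @` `[0, 1]) (x k),
    ball (f 0) (d 0%N) (x 0%N) &
    forall k, conn (ball (f 0) (d k) `\` f @` `[0, 1]) (x k) (x k.+1)].
Proof.
move=> d0.
have /choice[e He] k : exists e : R, 0 < e /\ forall x y,
    ball (f 0) e x -> ball (f 0) e y ->
    ~ (f @` `[0, 1]) x -> ~ (f @` `[0, 1]) y ->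
    conn (ball (f 0) (d k) `\` f @` `[0, 1]) x y.
  by have [e e0 He] := arc_conn_ball hn cf fI (d0 k); exists e.
(* [x k] takes part in the links at scales [k] and [k.-1], hence the first two bounds; the third
   places [x 0] in the ball of radius [d 0]. *)
pose m k := Num.min (Num.min (e k) (e k.-1)) (d 0%N).
have m0 k : 0 < m k by rewrite !lt_min d0 (He k).1 (He k.-1).1.
have /choice[x Hx] k : exists x, ball (f 0) (m k) x /\ ~ (f @` `[0, 1]) x.
  by have [x xm Nx] := arc_endpoint_not_interior hn cg gf (m0 k); exists x.
exists x; split => [k||k]; first exact: (Hx k).2.
  by apply: le_ball (Hx 0%N).1; rewrite ge_min lexx orbT.
apply: (He k).2; [| |exact: (Hx k).2|exact: (Hx k.+1).2].
  by apply: le_ball (Hx k).1; rewrite !ge_min lexx.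
by apply: le_ball (Hx k.+1).1; rewrite !ge_min lexx orbT.
Qed.

End EndpointSequence.

Lemma arc_complement_smooth_arc (R : realType) (n : nat) (f : R -> 'rV[R]_n)
    (g : 'rV[R]_n -> R) (Omega : set 'rV[R]_n) : (2 <= n)%N -> continuous f ->
  {within f @` `[0, 1], continuous g} -> (forall t, 0 <= t <= 1 -> g (f t) = t) ->
  open Omega -> f @` `[0, 1] `<=` Omega ->
  exists h : R -> 'rV[R]_n, [/\ h 0 = f 0 /\ h 1 = f 1,
    forall t, 0 <= t <= 1 -> {for t, continuous h},
    forall t, 0 < t < 1 -> (Omega `\` f @` `[0, 1]) (h t),
    forall s t, 0 < s < 1 -> 0 < t < 1 -> h s = h t -> s = t &
    forall t, 0 < t < 1 -> (forall k, derivable (derive1n k h) t 1) /\ derive1 h t != 0].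
Proof.
move=> hn cf cg gf oO fO; set lam := f @` `[0, 1].
have fI s t : 0 <= s <= 1 -> 0 <= t <= 1 -> f s = f t -> s = t.
  by move=> s01 t01 E; rewrite -(gf s s01) -(gf t t01) E.
have i0 : 0 <= (0 : R) <= 1 by rewrite lexx ler01.
have i1 : 0 <= (1 : R) <= 1 by rewrite lexx ler01.
have lamf t : 0 <= t <= 1 -> lam (f t) by move=> t01; exists t; rewrite //= in_itv.
have clam : closed lam.
  apply: compact_closed; first exact: norm_hausdorff.
  apply: continuous_compact; last exact: segment_compact.
  exact: continuous_subspaceT.
have [r [r0 rp rq]] : exists r : R, [/\ 0 < r, ball (f 0) r `<=` Omega &
    ball (f 1) r `<=` Omega].
  have /nbhs_ballP[a /= a0 ap] := open_nbhs_nbhs (conj oO (fO _ (lamf _ i0))).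
  have /nbhs_ballP[b /= b0 bq] := open_nbhs_nbhs (conj oO (fO _ (lamf _ i1))).
  exists (Num.min a b); split; first by rewrite lt_min a0.
    by apply: subset_trans ap; apply: le_ball; rewrite ge_min lexx.
  by apply: subset_trans bq; apply: le_ball; rewrite ge_min lexx orbT.
pose d (k : nat) : R := r / k.+1%:R.
have d0 k : 0 < d k by rewrite divr_gt0.
have d0r : d 0%N = r by rewrite /d divr1.
have dr k : d k <= r by rewrite ler_pdivrMr// ler_peMr ?ler1n// ltW.
have dlim (e : R) : 0 < e -> exists m, forall i, (m <= i)%N -> d i <= e.
  move=> e0; have [m _ Hm] := near_infty_natSinv_lt (PosNum (divr_gt0 e0 r0)).
  exists m => i /Hm /= /ltW; rewrite /d ler_pdivlMr// mulrC; exact.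
have [x [Nx x0 xx]] := endpoint_sequence hn cf fI cg gf d0.
have rev (t : R) : 0 <= t <= 1 -> 0 <= 1 - t <= 1.
  by move=> /andP[t0 t1]; apply/andP; split; lra.
have flam : (fun t => f (1 - t)) @` `[0, 1] = lam.
  apply/seteqP; split => _ [t /= + <-]; rewrite in_itv /= => t01; first exact/lamf/rev.
  by exists (1 - t); rewrite /= ?in_itv ?subKr//= rev.
have [y [Ny y0 yy]] : exists y : nat -> 'rV[R]_n, [/\ forall k, ~ lam (y k),
    ball (f 1) (d 0%N) (y 0%N) &
    forall k, conn (ball (f 1) (d k) `\` lam) (y k) (y k.+1)].
  (* The other endpoint is the first one of the reversed arc. *)
  have := @endpoint_sequence R n (fun t => f (1 - t)) (fun z => 1 - g z) hn _ _ _ _ d d0.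
  rewrite flam subr0; apply.
  - move=> t; apply: (@continuous_comp _ _ _ (fun t : R => 1 - t) f); last exact: cf.
    by apply: cvgB; [exact: cvg_cst|exact: cvg_id].
  - by move=> s t /rev s01 /rev t01 /fI => /(_ s01 t01); lra.
  - by move=> z; apply: cvgB; [exact: cvg_cst|exact: cg].
  - by move=> t /rev t01; rewrite gf// subKr.
have pq : f 0 != f 1 by apply/eqP => /fI => /(_ i0 i1)/eqP; rewrite eq_sym oner_eq0.
pose G := Omega `\` lam.
have oG : open G by apply: openI => //; rewrite openC.
have ballG c k : ball c r `<=` Omega -> ball c (d k) `\` lam `<=` G `&` ball c (d k).
  by move=> cO z [zd Nz]; split => //; split => //; apply: cO; apply: le_ball zd.
have xy : conn G (x 0%N) (y 0%N).
  have segO c z : ball c r `<=` Omega -> ball c r z -> conn Omega c z.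
    by move=> cO cz; apply: conn_segment => t t01; exact/cO/(ball_segment (ballxx _ r0) cz t01).
  have xyO : conn Omega (x 0%N) (y 0%N).
    rewrite d0r in x0 y0; apply: (@conn_trans _ _ _ _ (f 0)).
      exact/conn_sym/segO.
    apply: (@conn_trans _ _ _ _ (f 1)); last exact: segO.
    by exists f => //; split => // t t01; exact/fO/lamf.
  (* Off the complement of [Omega] the path [xyO] runs along the arc itself; off the arc, [arc_conn]
     gives a path that may leave [Omega]. *)
  have := @conn_setU_disjoint _ _ lam (~` Omega) (x 0%N) (y 0%N) clam.
  rewrite closedC setCK => /(_ oO) H.
  apply: (conn_sub _ (H _ (arc_conn hn cf fI (Nx 0%N) (Ny 0%N)) xyO)).
    by move=> z; rewrite setCU setCK => -[Nz Oz].
  by move=> z [/fO].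
have [| |k|k|C [HC CC CD Cq Cp]] := @chain_between R _ (f 0) (f 1) G x y d pq oG _ _ xy dlim.
- by case=> _; apply; exact: lamf.
- by case=> _; apply; exact: lamf.
- exact: conn_sub (ballG _ _ rp) (xx k).
- exact: conn_sub (ballG _ _ rq) (yy k).
exact: smooth_arc_in_chain HC CC CD Cq Cp.
Qed.

Unset Implicit Arguments.

Theorem theorem1p2 (R : realType) (n : nat) (hn : (2 <= n)%N)
  (lambda Omega : set 'rV[R]_n) :
  is_arc lambda -> open Omega -> lambda `<=` Omega ->
  exists gamma : set 'rV[R]_n,
    [/\ is_simple_closed_curve gamma, gamma `<=` Omega, lambda `<=` gamma &
        smooth_open_arc (gamma `\` lambda)].
Proof.
move=> [f0 [g [cf0 cg [f0l gl] [gf0 f0g]]]] oO lO.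
(* [f0] is continuous only within the unit interval and arbitrary outside; clamping the parameter
   gives a parametrization continuous on the whole line. *)
pose clip (t : R) : R := Num.max 0 (Num.min t 1).
have clip01 t : `[0, 1]%classic (clip t).
  by rewrite /= in_itv /= le_max lexx /= ge_max ler01 ge_min lexx orbT.
have clipE t : 0 <= t <= 1 -> clip t = t.
  by move=> /andP[t0 t1]; rewrite /clip min_l// max_r.
pose f := f0 \o clip.
have cclip : continuous clip.
  rewrite /clip => t.
  apply: (@continuous_max _ _ (fun=> 0) (fun t : R => Num.min t 1)); first exact: cvg_cst.
  by apply: (@continuous_min _ _ id (fun=> 1)); [exact: cvg_id|exact: cvg_cst].
have cf : continuous f by exact: continuous_comp_within cf0.
have fE t : 0 <= t <= 1 -> f t = f0 t by move=> t01; rewrite /f /= clipE.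
have lamE : f @` `[0, 1] = lambda.
  apply/seteqP; split => [_ [t t01 <-]|z lz].
    by apply: f0l; exists (clip t).
  have gz : `[0, 1]%classic (g z) by apply: gl; exists z.
  by exists (g z) => //; rewrite fE ?f0g//; move: gz; rewrite /= in_itv.
have gf t : 0 <= t <= 1 -> g (f t) = t.
  by move=> t01; rewrite fE// gf0//= in_itv.
have fI s t : 0 <= s <= 1 -> 0 <= t <= 1 -> f s = f t -> s = t.
  by move=> s01 t01 E; rewrite -(gf s s01) -(gf t t01) E.
rewrite -lamE in cg lO *.
have [h [[h0 h1] ch hO hI hsm]] := arc_complement_smooth_arc hn cf cg gf oO lO.
have [| |s t s01 t01 E|hC hD [k ck kh]] := glue_circle cf ch _ _ fI hI.
- by rewrite h0.
- by rewrite h1.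
- by have [_] := hO t t01; apply; rewrite -E; exists s; rewrite //= in_itv.
exists (f @` `[0, 1] `|` h @` `]0, 1[); split => //.
- move=> z [/lO //|[t /= + <-]]; rewrite in_itv /= => t01.
  by have [] := hO t t01.
- rewrite hD; exists h, k; split => //.
  + split => //; apply: continuous_in_subspaceT => t; rewrite inE /= in_itv /=.
    by move=> /andP[t0 t1]; apply: ch; rewrite !ltW.
  + split => // _ [_ [t + <-] <-]; rewrite /= !in_itv /= => t01.
    by rewrite kh.
  + split => // _ [t /= + <-]; rewrite in_itv /= => t01.
    by rewrite kh.
  + by move=> j t t01; have [] := hsm t t01.
  + by move=> t t01; have [] := hsm t t01.
Qed.
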